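(* Let $E_K$ be a simply connected surface of constant curvature $K$, or of variable negative curvature with supremum $K$. Let $S\subset E_K$ be a strip and $C=S\bmod M$ a cylinder with baseline $\gamma$ of length $l(\gamma)=l$, with Fermi coordinates $\psi(t,s)$ in which the metric is $h(t,s)^2dt^2+ds^2$, and let $H(t,s)=\int\frac{1}{h(t,s)}\,ds$ be an antiderivative in $s$ of $1/h$. Let $A\subset C$ be an annulus of type A, $$A=\psi\{(t,s)\mid s\in[a_1(t),a_2(t)],\ t\in[0,l]\},$$ and let $P\in\operatorname{Lip}(\bar A)$ be the function (with $P|_{\partial_1A}=0$, $P|_{\partial_2A}=1$) whose directional energy realizes $\operatorname{cap}_{\partial s}(A)$. Then $$E_A(P)\ \geq\ \operatorname{cap}(A)\ \geq\ \operatorname{cap}_{\partial s}(A)=E_A(\partial_2P)=\int_{t=0}^{l}\frac{1}{H(t,a_2(t))-H(t,a_1(t))}\,dt.$$ If $C$ has constant curvature $K$ (so that $h$ and $H$ depend only on $s$, $H(t,s)=H(s)$), then, with $q_i(t)=\frac{\partial H(s_0)}{\partial s}\big|_{s_0=a_i(t)}\cdot a_i'(t)$ for $i\in\{1,2\}$, $$\int_{t=0}^{l}\frac{1+\frac{q_1(t)^2+q_1(t)q_2(t)+q_2(t)^2}{3}}{H(a_2(t))-H(a_1(t))}\,dt\ \geq\ \operatorname{cap}(A)\ \geq\ \int_{t=0}^{l}\frac{1}{H(a_2(t))-H(a_1(t))}\,dt.$$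
   Context: Surfaces, strips, cylinders. $E_K$ is a complete simply connected Riemannian surface, either of constant curvature $K$ (rescaled hyperbolic plane, Euclidean plane, or round sphere) or of variable negative curvature with supremum $K$. Let $\gamma\subset E_K$ be a geodesic arc of length $l(\gamma)=l<\operatorname{diam}(E_K)$ with endpoints $p_1,p_2$. Fermi coordinates $\psi:[0,l]\times\,]a,b[\,\to E_K$ with base point $p_1$ and baseline $\gamma$, where $a<0\le b$ and $|b|\le|a|<\operatorname{diam}(E_K)/2$, are defined as follows: $\psi(t,s)$ is reached by moving from $p_1$ along $\gamma$ the directed distance $t$ and then along the geodesic perpendicular to $\gamma$ at that point the directed distance $s$. The image $S=\psi([0,l]\times\,]a,b[)$ is a strip. The cylinder $C=S\bmod M$ with baseline $\gamma$ is obtained by identifying the side of $S$ through $p_1$ with the side through $p_2$ by an orientation-preserving isometry $M\in\operatorname{Isom}^+(E_K)$ (assumed to exist). In the coordinates $(t,s)$ the metric is $h(t,s)^2dt^2+ds^2$ with $h>0$ and $h(t,0)=1$. In constant curvature $h(t,s)=h(s)=\cosh(ks)$ if $K=-k^2$, $h(s)=\cos(ks)$ if $K=k^2$, and $h(s)=1$ if $K=0$. Annuli. A (non-contractible) annulus on $C$ is a subset $A\subset C$ for which there is an isotopy $J:C\times[0,1]\to C$ with $J(\cdot,0)=\mathrm{id}$, $J(C,1)=A$. Its boundary has two connected components $\partial_1A,\partial_2A$. It is of type A if it can be written as $A=\psi\{(t,s)\mid s\in[a_1(t),a_2(t)],\,t\in[0,l]\}$ with $a_1,a_2$ piecewise differentiable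 functions of $t$; here $a_1<a_2$ and $\partial_iA$ is the curve $s=a_i(t)$. Energies and capacities. For $F\in\operatorname{Lip}(\bar A)$ (Lipschitz on the closure of $A$) and $f=F\circ\psi$, the energy and the directional energy are $$E_A(F)=\iint_{\psi^{-1}(A)}\frac{1}{h(t,s)}\Big(\frac{\partial f}{\partial t}\Big)^2+h(t,s)\Big(\frac{\partial f}{\partial s}\Big)^2ds\,dt,\qquad E_A(\partial_2F)=\iint_{\psi^{-1}(A)}h(t,s)\Big(\frac{\partial f}{\partial s}\Big)^2ds\,dt.$$ The capacity $\operatorname{cap}(A)$ and the directional capacity $\operatorname{cap}_{\partial s}(A)$ are the infima of $E_A(F)$, respectively $E_A(\partial_2F)$, over all $F\in\operatorname{Lip}(\bar A)$ with $F|_{\partial_1A}=0$ and $F|_{\partial_2A}=1$. *)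

(* Defs.v *)
From HB Require Import structures.
From mathcomp Require Import all_boot all_order all_algebra.
From mathcomp Require Import all_classical all_reals all_analysis.

Set Implicit Arguments.
Unset Strict Implicit.
Unset Printing Implicit Defensive.

Import Order.TTheory GRing.Theory Num.Theory.
Import numFieldNormedType.Exports.

Local Open Scope classical_set_scope.
Local Open Scope ring_scope.

(** * Calculus in the parameter plane *)

Definition d1 (R : realType) (f : R * R -> R) (u : R * R) : R :=
  derive1 (fun x => f (x, u.2)) u.1.

Definition d2 (R : realType) (f : R * R -> R) (u : R * R) : R :=
  derive1 (fun y => f (u.1, y)) u.2.

Fixpoint Ck_on (R : realType) (k : nat) (U : set (R * R)) (f : R * R -> R)
    : Prop :=
  (forall u, U u -> {for u, continuous f}) /\
  if k is k'.+1 then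
    [/\ forall u, U u -> derivable (fun x => f (x, u.2)) u.1 1,
        forall u, U u -> derivable (fun y => f (u.1, y)) u.2 1,
        Ck_on k' U (d1 f) & Ck_on k' U (d2 f)]
  else True.

Definition smooth_on (R : realType) (U : set (R * R)) (f : R * R -> R) : Prop :=
  forall k, Ck_on k U f.

Definition jacobian (R : realType) (phi : R * R -> R * R) (u : R * R) : R :=
  d1 (fst \o phi) u * d2 (snd \o phi) u - d2 (fst \o phi) u * d1 (snd \o phi) u.

(* [phi] is the change of parameters from the parametrization [x] (on [U]) to
   the parametrization [y] (on [V]): it is defined on the part of [U] that [x]
   sends into the image of [y].  Smoothness of its inverse is the same
   condition with the two parametrizations exchanged. *)
Definition transition (R : realType) (T : Type) (U : set (R * R))
    (x : R * R -> T) (V : set (R * R)) (y : R * R -> T)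
    (phi : R * R -> R * R) : Prop :=
  let W := U `&` x @^-1` (y @` V) in
  [/\ smooth_on W (fst \o phi), smooth_on W (snd \o phi) &
      forall u, W u -> [/\ V (phi u), y (phi u) = x u & 0 < jacobian phi u]].

Definition local_parametrization (R : realType) (T : topologicalType)
    (U : set (R * R)) (x : R * R -> T) : Prop :=
  [/\ open U,
      {in U &, injective x},
      forall u, U u -> {for u, continuous x} &
      forall V, open V -> V `<=` U -> open (x @` V)].

(** * Oriented Riemannian surfaces *)

(* [chart] is a maximal oriented smooth atlas, given by local parametrizations
   [x] of open parts of the surface by open sets [U] of the plane.
   [gE x], [gF x], [gG x] are the coefficients of the first fundamental form
   gE du^2 + 2 gF du dv + gG dv^2 in the parametrization [x]; the values of [x]
   and of the coefficients outside [U] carry no information. *)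
Record surface (R : realType) := Surface {
  carrier :> topologicalType;
  surface_hausdorff : hausdorff_space carrier;
  chart : set (R * R) -> (R * R -> carrier) -> Prop;
  chart_param : forall U x, chart U x -> local_parametrization U x;
  chart_cover : forall p : carrier,
    exists U x u, [/\ chart U x, U u & x u = p];
  chart_compat : forall U x V y, chart U x -> chart V y ->
    exists phi, transition U x V y phi;
  chart_maximal : forall U x, local_parametrization U x ->
    (forall V y, chart V y ->
       (exists phi, transition U x V y phi) /\
       (exists phi, transition V y U x phi)) ->
    chart U x;
  gE : (R * R -> carrier) -> R * R -> R;
  gF : (R * R -> carrier) -> R * R -> R;
  gG : (R * R -> carrier) -> R * R -> R;
  metric_smooth : forall U x, chart U x ->
    [/\ smooth_on U (gE x), smooth_on U (gF x) & smooth_on U (gG x)];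
  metric_pos : forall U x u, chart U x -> U u ->
    0 < gE x u /\ 0 < gE x u * gG x u - gF x u ^+ 2;
  metric_change : forall U x V y phi, chart U x -> chart V y ->
    transition U x V y phi ->
    forall u, U u -> (y @` V) (x u) ->
    let J11 := d1 (fst \o phi) u in let J12 := d2 (fst \o phi) u in
    let J21 := d1 (snd \o phi) u in let J22 := d2 (snd \o phi) u in
    let e := gE y (phi u) in let f := gF y (phi u) in let g := gG y (phi u) in
    [/\ gE x u = e * J11 ^+ 2 + 2 * f * J11 * J21 + g * J21 ^+ 2,
        gF x u = e * J11 * J12 + f * (J11 * J22 + J12 * J21) + g * J21 * J22 &
        gG x u = e * J12 ^+ 2 + 2 * f * J12 * J22 + g * J22 ^+ 2]
}.

Definition C1_curve (R : realType) (c : R -> R * R) : Prop :=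
  [/\ forall t, derivable (fst \o c) t 1, forall t, derivable (snd \o c) t 1,
      continuous (derive1 (fst \o c)) & continuous (derive1 (snd \o c))].

(* Length of [x \o c], for [c] a curve in the domain of [x]. *)
Definition curve_length (R : realType) (S : surface R) (x : R * R -> S)
    (c : R -> R * R) : R :=
  let du := derive1 (fst \o c) in let dv := derive1 (snd \o c) in
  \int[lebesgue_measure]_(t in `[0, 1])
    Num.sqrt (gE x (c t) * du t ^+ 2 + 2 * gF x (c t) * du t * dv t
              + gG x (c t) * dv t ^+ 2).

(* [path_length p q L]: some piecewise C^1 path from [p] to [q] has length [L];
   the path is cut into C^1 pieces each contained in a chart. *)
Inductive path_length (R : realType) (S : surface R) : S -> S -> R -> Prop :=
| path_piece U x c : chart U x -> C1_curve c ->
    (forall t, 0 <= t <= 1 -> U (c t)) ->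
    path_length (x (c 0)) (x (c 1)) (curve_length x c)
| path_concat p q r L1 L2 :
    path_length p q L1 -> path_length q r L2 -> path_length p r (L1 + L2).

Definition dist (R : realType) (S : surface R) (p q : S) : R :=
  inf [set L | path_length p q L].

Definition diameter (R : realType) (S : surface R) : \bar R :=
  ereal_sup [set (dist pq.1 pq.2)%:E | pq in [set: S * S]].

Definition complete_surface (R : realType) (S : surface R) : Prop :=
  forall p : nat -> S,
    (forall e, 0 < e -> exists N, forall m n, (N <= m)%N -> (N <= n)%N ->
       dist (p m) (p n) < e) ->
    exists q, (fun n => dist (p n) q) @ \oo --> (0 : R).

Definition simply_connected (R : realType) (T : topologicalType) : Prop :=
  [/\ exists p : T, True,
      forall p q : T, exists c : R -> T,
        [/\ {within `[0, 1], continuous c}, c 0 = p & c 1 = q] &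
      forall c : R -> T, {within `[0, 1], continuous c} -> c 0 = c 1 ->
        exists D : R * R -> T,
          [/\ {within `[0, 1] `*` `[0, 1], continuous D},
              forall t, 0 <= t <= 1 -> D (0, t) = c t,
              forall t, 0 <= t <= 1 -> D (1, t) = D (1, 0) &
              forall r, 0 <= r <= 1 -> D (r, 0) = D (r, 1)]].

Definition det3 (R : realType) (a b c d e f g h i : R) : R :=
  a * (e * i - f * h) - b * (d * i - f * g) + c * (d * h - e * g).

(* Brioschi's formula for the Gaussian curvature of E du^2 + 2F du dv + G dv^2. *)
Definition brioschi (R : realType) (E F G : R * R -> R) (u : R * R) : R :=
  (det3 (- d2 (d2 E) u / 2 + d2 (d1 F) u - d1 (d1 G) u / 2)
          (d1 E u / 2) (d1 F u - d2 E u / 2)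
        (d2 F u - d1 G u / 2) (E u) (F u)
        (d2 G u / 2) (F u) (G u)
   - det3 0 (d2 E u / 2) (d1 G u / 2)
          (d2 E u / 2) (E u) (F u)
          (d1 G u / 2) (F u) (G u))
  / (E u * G u - F u ^+ 2) ^+ 2.

Definition gauss_curvature (R : realType) (S : surface R) (kappa : S -> R)
    : Prop :=
  forall U x u, chart U x -> U u ->
    brioschi (gE x) (gF x) (gG x) u = kappa (x u).

Definition constant_curvature (R : realType) (S : surface R) (K : R) : Prop :=
  gauss_curvature (fun _ : S => K).

Definition variable_negative_curvature (R : realType) (S : surface R) (K : R)
    : Prop :=
  exists kappa : S -> R,
    [/\ gauss_curvature kappa, forall p, kappa p < 0 & sup (range kappa) = K].

Definition surface_EK (R : realType) (S : surface R) (K : R) : Prop :=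
  [/\ complete_surface S, simply_connected R S &
      constant_curvature S K \/ variable_negative_curvature S K].

(* Orientation-preserving because the atlas is oriented; the inverse has the
   same property by maximality of the atlas. *)
Definition isom_plus (R : realType) (S : surface R) (M : S -> S) : Prop :=
  bijective M /\
  forall U x, chart U x ->
    chart U (M \o x) /\
    forall u, U u -> [/\ gE (M \o x) u = gE x u, gF (M \o x) u = gF x u &
                         gG (M \o x) u = gG x u].

(* The curve [w] satisfies the geodesic equations at time [t]: in every chart
   they are the Euler-Lagrange equations
     (E u' + F v')' = (E_u u'^2 + 2 F_u u'v' + G_u v'^2) / 2
     (F u' + G v')' = (E_v u'^2 + 2 F_v u'v' + G_v v'^2) / 2. *)
Definition geodesic_at (R : realType) (S : surface R) (w : R -> S) (t : R)
    : Prop :=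
  {for t, continuous w} /\
  forall U x (c : R -> R * R), chart U x ->
    (\forall r \near t, U (c r) /\ x (c r) = w r) ->
    let du := derive1 (fst \o c) in let dv := derive1 (snd \o c) in
    [/\ \forall r \near t,
          derivable (fst \o c) r 1 /\ derivable (snd \o c) r 1,
        is_derive t 1 (fun r => gE x (c r) * du r + gF x (c r) * dv r)
          ((d1 (gE x) (c t) * du t ^+ 2 + 2 * d1 (gF x) (c t) * du t * dv t
            + d1 (gG x) (c t) * dv t ^+ 2) / 2) &
        is_derive t 1 (fun r => gF x (c r) * du r + gG x (c r) * dv r)
          ((d2 (gE x) (c t) * du t ^+ 2 + 2 * d2 (gF x) (c t) * du t * dv t
            + d2 (gG x) (c t) * dv t ^+ 2) / 2)].

(** * Fermi coordinates, strips and cylinders *)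

(* The base point is [psi (0, 0)] and the baseline is [t |-> psi (t, 0)] for
   [0 <= t <= l].  Since the strip contains its two sides, [psi] is taken on a
   slightly longer piece of the complete geodesic through the baseline, and for
   [s] in the symmetric interval ]a, -a[, which contains ]a, b[ and 0 (note that
   [b = 0] is allowed).  The conditions say that the baseline and the lines
   [s |-> psi (t, s)] are unit speed geodesics, perpendicular at [s = 0]. *)
Definition fermi_coordinates (R : realType) (S : surface R) (l a : R)
    (psi : R * R -> S) : Prop :=
  exists2 eps, 0 < eps &
    [/\ chart (`]- eps, l + eps[ `*` `]a, - a[) psi,
        forall t, - eps < t < l + eps ->
          [/\ geodesic_at (fun t' => psi (t', 0)) t,
              gE psi (t, 0) = 1 & gF psi (t, 0) = 0] &
        forall t s, - eps < t < l + eps -> a < s < - a ->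
          geodesic_at (fun s' => psi (t, s')) s /\ gG psi (t, s) = 1].

Definition strip_dom (R : realType) (l a b : R) : set (R * R) :=
  `[0, l] `*` `]a, b[.

Definition strip (R : realType) (S : surface R) (l a b : R) (psi : R * R -> S)
    : set S :=
  psi @` strip_dom l a b.

Definition fermi_metric (R : realType) (S : surface R) (l a b : R)
    (psi : R * R -> S) (h : R -> R -> R) : Prop :=
  forall t s, strip_dom l a b (t, s) ->
    [/\ 0 < h t s, gE psi (t, s) = h t s ^+ 2, gF psi (t, s) = 0 &
        gG psi (t, s) = 1].

(* The curvature of C is that of the surface along the strip. *)
Definition cyl_constant_curvature (R : realType) (S : surface R) (l a b : R)
    (psi : R * R -> S) (K : R) : Prop :=
  forall U x u, chart U x -> U u -> strip l a b psi (x u) ->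
    brioschi (gE x) (gF x) (gG x) u = K.

(* The cylinder C = S mod M is the strip with [p] and [M p] identified for all
   [p] on the side through the base point. *)
Definition gluing (R : realType) (S : surface R) (l a b : R)
    (psi : R * R -> S) (M : S -> S) : Prop :=
  isom_plus M /\ forall s, a < s < b -> M (psi (0, s)) = psi (l, s).

(* Paths on C: pieces inside the strip, and passages between identified points
   of the two sides. *)
Inductive cyl_path_length (R : realType) (S : surface R) (l a b : R)
    (psi : R * R -> S) (M : S -> S) : S -> S -> R -> Prop :=
| cyl_piece c : C1_curve c ->
    (forall t, 0 <= t <= 1 -> strip_dom l a b (c t)) ->
    cyl_path_length l a b psi M (psi (c 0)) (psi (c 1)) (curve_length psi c)
| cyl_cross s : a < s < b ->
    cyl_path_length l a b psi M (psi (0, s)) (M (psi (0, s))) 0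
| cyl_cross_back s : a < s < b ->
    cyl_path_length l a b psi M (M (psi (0, s))) (psi (0, s)) 0
| cyl_concat p q r L1 L2 :
    cyl_path_length l a b psi M p q L1 -> cyl_path_length l a b psi M q r L2 ->
    cyl_path_length l a b psi M p r (L1 + L2).

(* The distance of C; two points of the strip are the same point of C iff
   their distance is 0. *)
Definition cyl_dist (R : realType) (S : surface R) (l a b : R)
    (psi : R * R -> S) (M : S -> S) (p q : S) : R :=
  inf [set L | cyl_path_length l a b psi M p q L].

Definition cyl_closure (R : realType) (S : surface R) (l a b : R)
    (psi : R * R -> S) (M : S -> S) (A : set S) : set S :=
  [set q | strip l a b psi q /\
     forall e, 0 < e -> exists2 p, A p & cyl_dist l a b psi M q p < e].

(* Isotopy of the cylinder starting at the identity: a continuous family of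
   injective (hence open) continuous maps of C into itself. *)
Definition cyl_isotopy (R : realType) (S : surface R) (l a b : R)
    (psi : R * R -> S) (M : S -> S) (J : S -> R -> S) : Prop :=
  let C := strip l a b psi in
  let d := cyl_dist l a b psi M in
  [/\ forall p r, C p -> 0 <= r <= 1 -> C (J p r),
      forall p r, C p -> 0 <= r <= 1 -> forall e, 0 < e ->
        exists2 delta, 0 < delta & forall p' r', C p' -> 0 <= r' <= 1 ->
          d p p' < delta -> `|r - r'| < delta -> d (J p r) (J p' r') < e,
      forall p q r, C p -> C q -> 0 <= r <= 1 ->
        d (J p r) (J q r) = 0 -> d p q = 0 &
      forall p, C p -> d (J p 0) p = 0].

(* J(C, 1) = A is read up to boundary points: J(C, 1) is homeomorphic to the
   open cylinder C, while A may contain its two boundary curves. *)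
Definition annulus (R : realType) (S : surface R) (l a b : R)
    (psi : R * R -> S) (M : S -> S) (A : set S) : Prop :=
  exists2 J, cyl_isotopy l a b psi M J &
    let J1 := [set q | strip l a b psi q /\ exists2 p, strip l a b psi p &
                         cyl_dist l a b psi M (J p 1) q = 0] in
    J1 `<=` A /\ A `<=` cyl_closure l a b psi M J1.

(* Differentiable off finitely many points, with bounded difference quotients:
   the boundary curves of a type A annulus have to be Lipschitz for the
   extremal function of the directional capacity to be Lipschitz up to the
   boundary. *)
Definition piecewise_differentiable (R : realType) (l : R) (f : R -> R) : Prop :=
  (exists k, forall t t', 0 <= t <= l -> 0 <= t' <= l ->
     `|f t - f t'| <= k * `|t - t'|) /\
  exists D : seq R, forall t, 0 < t < l -> t \notin D -> derivable f t 1.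

(* [a1] and [a2] describe closed curves on the cylinder. *)
Definition type_A (R : realType) (S : surface R) (l a b : R)
    (psi : R * R -> S) (a1 a2 : R -> R) (A : set S) : Prop :=
  [/\ piecewise_differentiable l a1 /\ piecewise_differentiable l a2,
      forall t, 0 <= t <= l -> [/\ a < a1 t, a1 t < a2 t & a2 t < b],
      a1 0 = a1 l /\ a2 0 = a2 l &
      A = psi @` [set u | 0 <= u.1 <= l /\ a1 u.1 <= u.2 <= a2 u.1]].

(** * Energies and capacities *)

Definition energy (R : realType) (S : surface R) (l a b : R)
    (psi : R * R -> S) (h : R -> R -> R) (A : set S) (F : S -> R) : \bar R :=
  let f := F \o psi in
  (\int[(@lebesgue_measure R \x @lebesgue_measure R)]_(u in
       strip_dom l a b `&` psi @^-1` A)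
     ((h u.1 u.2)^-1 * d1 f u ^+ 2 + h u.1 u.2 * d2 f u ^+ 2)%:E)%E.

Definition dir_energy (R : realType) (S : surface R) (l a b : R)
    (psi : R * R -> S) (h : R -> R -> R) (A : set S) (F : S -> R) : \bar R :=
  let f := F \o psi in
  (\int[(@lebesgue_measure R \x @lebesgue_measure R)]_(u in
       strip_dom l a b `&` psi @^-1` A)
     (h u.1 u.2 * d2 f u ^+ 2)%:E)%E.

(* A function on C is a function on the strip; the Lipschitz condition for the
   distance of C makes it compatible with the identification of the sides. *)
Definition Lip (R : realType) (S : surface R) (l a b : R)
    (psi : R * R -> S) (M : S -> S) (B : set S) (F : S -> R) : Prop :=
  exists k, forall p q, B p -> B q ->
    `|F p - F q| <= k * cyl_dist l a b psi M p q.

Definition admissible (R : realType) (S : surface R) (l a b : R)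
    (psi : R * R -> S) (M : S -> S) (a1 a2 : R -> R) (A : set S) (F : S -> R)
    : Prop :=
  [/\ Lip l a b psi M (cyl_closure l a b psi M A) F,
      forall t, 0 <= t <= l -> F (psi (t, a1 t)) = 0 &
      forall t, 0 <= t <= l -> F (psi (t, a2 t)) = 1].

Definition cap (R : realType) (S : surface R) (l a b : R)
    (psi : R * R -> S) (M : S -> S) (h : R -> R -> R) (a1 a2 : R -> R)
    (A : set S) : \bar R :=
  ereal_inf [set energy l a b psi h A F | F in admissible l a b psi M a1 a2 A].

Definition dir_cap (R : realType) (S : surface R) (l a b : R)
    (psi : R * R -> S) (M : S -> S) (h : R -> R -> R) (a1 a2 : R -> R)
    (A : set S) : \bar R :=
  ereal_inf [set dir_energy l a b psi h A F
            | F in admissible l a b psi M a1 a2 A].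

Definition dir_extremal (R : realType) (S : surface R) (l a b : R)
    (psi : R * R -> S) (M : S -> S) (h : R -> R -> R) (a1 a2 : R -> R)
    (A : set S) (P : S -> R) : Prop :=
  admissible l a b psi M a1 a2 A P /\
  dir_energy l a b psi h A P = dir_cap l a b psi M h a1 a2 A.

(* Main.v *)
Require Import Defs.
From HB Require Import structures.
From mathcomp Require Import all_boot all_order all_algebra.
From mathcomp Require Import all_classical all_reals all_analysis.
From mathcomp Require Import measurable_realfun.
From mathcomp Require Import ring lra.

Set Implicit Arguments.
Unset Strict Implicit.
Unset Printing Implicit Defensive.

Import Order.TTheory GRing.Theory Num.Theory.
Import numFieldNormedType.Exports.

Local Open Scope classical_set_scope.
Local Open Scope ring_scope.

(** Write [D t = H t (a2 t) - H t (a1 t)], the integral of [1 / h] over the part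
of the annulus on the line [t = const].

Lower bound.  The directional energy of an admissible function is an integral
over [t] of one-dimensional energies, and on each line Cauchy-Schwarz
([slice_lower_bound]) bounds the one-dimensional energy from below by
[(D t)^-1], because the function grows from 0 to 1.  The function is only
Lipschitz, so this rests on the fundamental theorem of calculus for Lipschitz
functions ([lipschitz_diff_le_integral]), proved with the Radon-Nikodym theorem
and Lebesgue differentiation.  As the energy is at least the directional
energy, the bound holds for both capacities.

Attainment.  Equality holds for the function
[(H t s - H t (a1 t)) / D t] ([extremal_profile], [dir_energy_extremal]).  The
work is to see that it is Lipschitz for the distance of the cylinder
([extremal_profile_lipschitz], [path_lipschitz]) and that it is compatible with
the gluing of the two sides.  For the latter, [h] must be the same function of
[s] on both sides.  It satisfies the Jacobi equation [h_ss = - K h] with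
[h = 1] and [h_s = 0] on the baseline ([fermi_first_form],
[brioschi_orthogonal]), and the curvatures along the two sides agree since an
isometry exchanges the sides; a Wronskian argument
([metric_eq_of_curvature_eq]) concludes.  The same argument shows that [h] does
not depend on [t] if the curvature is constant along the strip.

Upper bound.  In that case [H] depends on [s] only, the derivative of the
extremal profile in [t] is explicit ([extremal_profile_d1E]), and the
substitution [z = H s] turns the energy on each line into the integral of a
quadratic polynomial ([extremal_section_energy]). *)

(** * Integrals and measurability in the plane *)

(** The integral of a nonnegative function is the supremum of the integrals of
the simple functions below it, so it is monotone without any measurability.
This is needed because the pullback of an admissible function is arbitrary off
the annulus, so that its partial derivatives are not controlled on the two
boundary curves. *)
Lemma ge0_le_integral_lower d (T : measurableType d) (R : realType)
    (mu : {measure set T -> \bar R}) (D : set T) (f g : T -> \bar R) :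
  (forall x, D x -> (0 <= f x)%E) -> (forall x, D x -> (f x <= g x)%E) ->
  (\int[mu]_(x in D) f x <= \int[mu]_(x in D) g x)%E.
Proof.
move=> f0 fg.
have g0 x : D x -> (0 <= g x)%E by move=> Dx; exact: le_trans (f0 _ Dx) (fg _ Dx).
rewrite !ge0_integralE//; apply: ereal_sup_le => _ [s sf <-].
exists s => // x; apply: le_trans (sf x) _.
by rewrite /patch; case: ifPn => // /set_mem; exact: fg.
Qed.

Lemma ge0_subset_integral_lower d (T : measurableType d) (R : realType)
    (mu : {measure set T -> \bar R}) (D D' : set T) (f : T -> \bar R) :
  D `<=` D' -> (forall x, D' x -> (0 <= f x)%E) ->
  (\int[mu]_(x in D) f x <= \int[mu]_(x in D') f x)%E.
Proof.
move=> DD' f0; rewrite integral_mkcond [leRHS]integral_mkcond.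
apply: ge0_le_integral_lower => x _; rewrite /patch.
  by case: ifPn => // /set_mem /DD'; exact: f0.
case: ifPn => [/set_mem /DD' D'x|_]; first by rewrite mem_set.
by case: ifPn => // /set_mem; exact: f0.
Qed.

Lemma open_prod_measurable (R : realType) (U : set (R * R)) :
  open U -> measurable U.
Proof.
move=> oU.
pose B (q : (rat * rat) * (rat * rat)) : set (R * R) :=
  `]ratr q.1.1, ratr q.1.2[ `*` `]ratr q.2.1, ratr q.2.2[.
have -> : U = \bigcup_(q in [set q | B q `<=` U]) B q.
  apply/seteqP; split => [[x y] Uxy|u [q /= qU]]; last exact: qU.
  have [/= e e0 eU] : exists2 e : R, 0 < e & ball (x, y) e `<=` U.
    by apply/nbhs_ballP; exact: open_nbhs_nbhs.
  have rat_near (z : R) : exists p q : rat,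
      [/\ z - e < ratr p, ratr p < z, z < ratr q & ratr q < z + e].
    have [|p] := @rat_in_itvoo R (z - e) z; first by rewrite ltrBlDr ltrDl.
    rewrite in_itv/= => /andP[p1 p2].
    have [|q] := @rat_in_itvoo R z (z + e); first by rewrite ltrDl.
    by rewrite in_itv/= => /andP[q1 q2]; exists p, q.
  have [p1 [q1 [a1 a2 a3 a4]]] := rat_near x.
  have [p2 [q2 [b1 b2 b3 b4]]] := rat_near y.
  exists ((p1, q1), (p2, q2)); last by split; rewrite /= in_itv/= ?a2 ?b2.
  move=> [u v] [/=]; rewrite !in_itv/= => /andP[u1 u2] /andP[v1 v2].
  apply: eU; split; rewrite /ball/= ltr_norml; apply/andP; split; lra.
rewrite bigcup_mkcond; apply: countable_bigcupT_measurable => // q.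
by case: ifP => // _; exact: measurableX.
Qed.

Lemma closed_prod_measurable (R : realType) (U : set (R * R)) :
  closed U -> measurable U.
Proof.
move=> /closed_openC oU; rewrite -(setCK U); apply: measurableC.
exact: open_prod_measurable.
Qed.

Lemma continuous_prod_measurable_fun (R : realType) (W : set (R * R))
    (f : R * R -> R) :
  open W -> (forall u, W u -> {for u, continuous f}) -> measurable_fun W f.
Proof.
move=> oW cf mW; apply: (measurability _ (RGenOInfty.measurableE R)) => // _ [_ [r ->] <-].
apply: open_prod_measurable.
rewrite openE => u [Wu]; rewrite /= in_itv/= andbT => rfu.
apply: filterI; first exact: open_nbhs_nbhs.
near=> v; rewrite /= in_itv/= andbT; near: v.
exact: (cf _ Wu) (open_nbhs_nbhs (conj (@open_gt R r) rfu)).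
Unshelve. all: end_near. Qed.

Lemma invn_cvg_dnbhs0 (R : realType) : (n.+1%:R^-1 : R) @[n --> \oo] --> 0^'.
Proof.
move=> A /= [e /= e0 eA].
have := @cvg_harmonic R; move/cvgrPdist_lt => /(_ _ e0); apply: filterS => n /= ne.
by apply: eA => //=; rewrite gt_eqF.
Qed.

(** The difference quotients converge at a point iff they are Cauchy there, and
for given tolerances the Cauchy condition is closed; hence the points of
differentiability form a Borel set.  On it the derivative is a limit of
continuous functions, and off it [derive1] is constant. *)
Lemma measurable_d2 (R : realType) (f : R * R -> R) :
  continuous f -> measurable_fun setT (d2 f).
Proof.
move=> cf.
pose Q (p : R) (u : R * R) : R := p^-1 * (f (u.1, p + u.2) - f u).
have cQ p : continuous (Q p).
  move=> [x y]; apply: cvgMr; apply: cvgB; last exact: cf.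
  apply: (@cvg_comp _ _ _ (fun v : R * R => (v.1, p + v.2)) f); last exact: cf.
  have h1 : v.1 @[v --> (x, y)] --> x by exact: cvg_fst.
  have h2 : (p + v.2) @[v --> (x, y)] --> p + y.
    by apply: cvgD; [exact: cvg_cst|exact: cvg_snd].
  exact: (cvg_pair h1 h2).
pose small n := [set pq : R * R | [/\ pq.1 != 0, pq.2 != 0,
  `|pq.1| < n.+1%:R^-1 & `|pq.2| < n.+1%:R^-1]].
pose Der := \bigcap_k \bigcup_n \bigcap_(pq in small n)
  [set u | `|Q pq.1 u - Q pq.2 u| <= (k : nat).+1%:R^-1].
have mDer : measurable Der.
  apply: bigcapT_measurable => k; apply: bigcupT_measurable => n.
  apply: closed_prod_measurable; apply: closed_bigI => pq _.
  apply: (@preimage_closed _ _ (fun u => `|Q pq.1 u - Q pq.2 u|) [set x | x <= _]).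
    by move=> u _; apply: cvg_norm; apply: cvgB; exact: cQ.
  exact: closed_le.
have cvgDer u : cvg (Q p u @[p --> 0^']) <-> Der u.
  split=> [/cauchy_cvgP/cauchy_ballP Qc k _|Du].
    have k0 : 0 < (k.+1%:R^-1 : R) by [].
    have [[A B] [/= [e1 e10 A1] [e2 e20 B1]] AB] := Qc _ k0.
    have e0 : 0 < Num.min e1 e2 by rewrite lt_min e10.
    have /cvgrPdist_lt/(_ _ e0) [n _ /(_ n (leqnn _)) /=] := @cvg_harmonic R.
    rewrite sub0r normrN ger0_norm// lt_min => /andP[n1 n2].
    exists n => // -[p q] [/= p0 q0 pn qn].
    have : ball (Q p u) k.+1%:R^-1 (Q q u).
      apply: (AB (Q p u, Q q u)); split => /=.
      - by apply: A1 => //=; rewrite sub0r normrN (lt_trans pn).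
      - by apply: B1 => //=; rewrite sub0r normrN (lt_trans qn).
    by move/ltW.
  apply/cauchy_cvgP/cauchy_ballP => e e0.
  have /cvgrPdist_lt/(_ _ e0) [k _ /(_ k (leqnn _)) /=] := @cvg_harmonic R.
  rewrite sub0r normrN ger0_norm// => ke.
  have [n _ nQ] := Du k I.
  have n0 : 0 < (n.+1%:R^-1 : R) by [].
  exists ([set Q p u | p in [set p | p != 0 /\ `|p| < n.+1%:R^-1]],
          [set Q p u | p in [set p | p != 0 /\ `|p| < n.+1%:R^-1]]).
    by split; exists n.+1%:R^-1 => //= p; rewrite /= sub0r normrN => pn p0;
      exists p.
  move=> [_ _] [/= [p [p0 pn] <-] [q [q0 qn] <-]].
  by rewrite /ball/=; apply: le_lt_trans ke; exact: (nQ (p, q)).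
have d2E u : d2 f u = lim (Q p u @[p --> 0^']) by case: u.
rewrite -(setvU Der); apply/measurable_funU => //; first exact: measurableC.
split.
  apply: (@eq_measurable_fun _ _ _ _ _ (cst point)) => // u.
  by rewrite inE => /= /cvgDer nQ; rewrite d2E dvgP.
apply: (@measurable_fun_cvg _ _ _ _ (fun n => Q n.+1%:R^-1)) => [n|u /cvgDer Du].
  apply: (measurable_funS measurableT) => //.
  by apply: continuous_prod_measurable_fun => // *; [exact: openT|exact: cQ].
by rewrite d2E; exact: (cvg_comp _ _ (@invn_cvg_dnbhs0 R) Du).
Qed.

Lemma measurable_d1 (R : realType) (f : R * R -> R) :
  continuous f -> measurable_fun setT (d1 f).
Proof.
move=> cf; pose sw (v : R * R) := (v.2, v.1).
have -> : d1 f = d2 (f \o sw) \o sw by apply/funext => -[].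
apply: measurableT_comp; last exact: measurable_swap.
apply: measurable_d2 => -[x y]; apply: (@cvg_comp _ _ _ sw f); last exact: cf.
have h1 : v.2 @[v --> (x, y)] --> y by exact: cvg_snd.
have h2 : v.1 @[v --> (x, y)] --> x by exact: cvg_fst.
exact: (cvg_pair h1 h2).
Qed.

(** * The fundamental theorem of calculus for Lipschitz functions *)

Lemma lebesgue_stieltjes_measure_oc (R : realType) (G : cumulative R R) (a b : R) : a <= b ->
  lebesgue_stieltjes_measure G `]a, b] = (G b - G a)%:E.
Proof.
move=> ab; rewrite /lebesgue_stieltjes_measure /= /measure_extension.
rewrite measurable_mu_extE/=; last exact: is_ocitv.
by rewrite wlength_itv_bnd// EFinB.
Qed.

(** The Stieltjes measures of [G] and of [s - G s] add up to Lebesgue measure.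
So the first one is absolutely continuous, its Radon-Nikodym density integrates
to the increments of [G], and by Lebesgue differentiation it is the derivative
of [G] almost everywhere. *)
Lemma monotone_increment_density (R : realType) (G : R -> R) (a b : R) :
  a < b -> {homo G : x y / x <= y} -> {homo (fun s => s - G s) : x y / x <= y} ->
  continuous G ->
  exists f : R -> R,
    [/\ lebesgue_measure.-integrable setT (EFin \o f),
      (forall s, a < s -> s <= b ->
        G s - G a = \int[lebesgue_measure]_(t in `]a, s]) f t) &
      {ae lebesgue_measure, forall s, a < s < b -> derivable G s 1 /\ derive1 G s = f s}].
Proof.
move=> ab G1 G2 cG.
pose G' s := s - G s.
have cG' : continuous G' by move=> x; apply: cvgB; [exact: cvg_id|exact: cG].
have rc1 : right_continuous G by exact: right_continuousW.
have rc2 : right_continuous G' by exact: right_continuousW.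
pose C1 := HB.pack_for (cumulative R R) G (@isCumulative.Build R _ R G G1 rc1).
pose C2 := HB.pack_for (cumulative R R) G' (@isCumulative.Build R _ R G' G2 rc2).
pose m1 : {measure set (measurableTypeR R) -> \bar R} := lebesgue_stieltjes_measure C1.
pose m2 : {measure set (measurableTypeR R) -> \bar R} := lebesgue_stieltjes_measure C2.
have m1E x y : x <= y -> m1 `]x, y]%classic = (G y - G x)%:E.
  exact: (lebesgue_stieltjes_measure_oc C1).
have m2E x y : x <= y -> m2 `]x, y]%classic = (G' y - G' x)%:E.
  exact: (lebesgue_stieltjes_measure_oc C2).
have sumE A : measurable A -> lebesgue_measure A = (m1 A + m2 A)%E.
  move=> mA; rewrite -[(m1 A + m2 A)%E](measure_addE m1 m2 A).
  apply: lebesgue_measure_unique => // X /ocitvP[->|[x x12 ->]].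
    by rewrite !measure0.
  transitivity (m1 `]x.1, x.2]%classic + m2 `]x.1, x.2]%classic)%E; last exact/esym/measure_addE.
  rewrite m1E ?m2E ?ltW// [LHS](@lebesgue_stieltjes_measure_oc _ idfun) ?ltW//= -EFinD.
  by congr (_%:E); rewrite /G'; ring.
have mI : measurable (`]a, b]%classic : set (measurableTypeR R)) by [].
have m1oo : (m1 `]a, b]%classic < +oo)%E by rewrite m1E ?ltW// ltry.
pose nu : {finite_measure set _ -> \bar R} := mfrestr mI m1oo.
have nu_dom : nu `<< (@lebesgue_measure R).
  apply/null_content_dominatesP => A mA A0.
  apply/eqP; rewrite eq_le measure_ge0 andbT.
  apply: (@le_trans _ _ (m1 A)); last first.
    by rewrite -A0 [leRHS](sumE A)// leeDl.
  by rewrite /nu/= /mfrestr /mrestr le_measure ?inE//; exact: measurableI.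
have [f [f0 ffin intf nuE]] := radon_nikodym_sigma_finite nu_dom.
pose g := fine \o f.
have gE : EFin \o g = f by apply/funext => x /=; rewrite fineK.
have FE s : a < s -> s <= b -> G s - G a = \int[lebesgue_measure]_(t in `]a, s]) g t.
  move=> sa sb; rewrite /Rintegral.
  under eq_integral do rewrite -[(g _)%:E]/((EFin \o g) _) gE.
  rewrite -nuE// /nu/= /mfrestr /mrestr setIidl ?m1E ?(ltW sa)//.
  by apply: subset_itvl; rewrite bnd_simp.
exists g; split; rewrite ?gE//.
have h1 y : lebesgue_measure.-integrable [set` Interval (BRight a) (BRight y)] (EFin \o g).
  by rewrite gE; exact: integrableS intf.
have h2 : locally_integrable [set: R] g.
  by apply: open_integrable_locally; [exact: openT|rewrite gE].
have := FTC1 h1 h2; apply: filterS; first exact: (ae_filter_ringOfSetsType (@lebesgue_measure R)).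
move=> s gs /andP[sa sb].
have as_ : (BRight a < BRight s :> itv_bound R)%O by rewrite bnd_simp.
have [] := gs as_.
set F := (fun x => _) => dF F's.
have nFG : \forall y \near s, F y + G a = G y.
  near=> y; rewrite /F -FE ?subrK//.
    by near: y; exact: lt_nbhsr.
  by apply: ltW; near: y; exact: lt_nbhsl.
split.
  apply: (near_eq_derivable nFG).
  by apply: derivableD => //; exact: derivable_cst.
rewrite -F's !derive1E -(near_eq_derive _ nFG).
by rewrite deriveD// ?derive_cst ?addr0//; exact: derivable_cst.
Unshelve. all: end_near. Qed.

Lemma lipschitz_continuous (R : realType) (g : R -> R) (k : R) :
  (forall x y, `|g x - g y| <= k * `|x - y|) -> continuous g.
Proof.
move=> gk x; apply/cvgrPdist_le => e e0.
have k0 : 0 < `|k| + 1 by rewrite ltr_wpDl.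
near=> y; apply: le_trans (gk _ _) _.
apply: (@le_trans _ _ ((`|k| + 1) * `|x - y|)).
  by rewrite ler_wpM2r// (le_trans (ler_norm _))// lerDl.
rewrite -ler_pdivlMl// mulrC; near: y.
apply: cvgr_dist_le; first exact: cvg_id.
by rewrite divr_gt0.
Unshelve. all: end_near. Qed.

Lemma measurable_derive1 (R : realType) (g : R -> R) :
  continuous g -> measurable_fun setT (derive1 g).
Proof.
move=> cg.
have -> : derive1 g = d2 (g \o snd) \o pair (0 : R) by apply/funext.
apply: measurableT_comp; last exact: measurable_fun_pair.
by apply: measurable_d2 => -[x y]; apply: cvg_comp; [exact: cvg_snd|exact: cg].
Qed.

(** A Lipschitz function is differentiable almost everywhere and is controlled
by the integral of its derivative: if [g] is [c]-Lipschitz, then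
[(s + g s / c) / 2] and its difference with [s] are both nondecreasing, and
[monotone_increment_density] applies.  Almost everywhere differentiability is
essential below, as [derive1] takes a default value elsewhere. *)
Lemma lipschitz_diff_le_integral (R : realType) (g : R -> R) (k a b : R) :
  (forall x y, `|g x - g y| <= k * `|x - y|) -> a < b ->
  ((g b - g a)%:E <= \int[lebesgue_measure]_(s in `]a, b[) `|derive1 g s|%:E)%E.
Proof.
move=> gk' ab.
(* A Lipschitz constant by which one can divide. *)
pose c := `|k| + 1.
have c0 : 0 < c by rewrite ltr_wpDl.
have gk x y : `|g x - g y| <= c * `|x - y|.
  apply: le_trans (gk' _ _) _; rewrite ler_wpM2r//.
  by rewrite (le_trans (ler_norm _))// lerDl.
have cg := lipschitz_continuous gk.
have mg := measurable_derive1 cg.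
pose G s := (s + g s / c) / 2.
have gle x y : x <= y -> `|g y / c - g x / c| <= y - x.
  move=> xy; rewrite -mulrBl normrM (@ger0_norm _ c^-1); last by rewrite invr_ge0 ltW.
  rewrite ler_pdivrMr// mulrC; have := gk y x.
  by rewrite (@ger0_norm _ (y - x)) ?subr_ge0.
have G1 : {homo G : x y / x <= y}.
  move=> x y xy; rewrite /G ler_pM2r ?invr_gt0//.
  by have := gle _ _ xy; rewrite ler_norml => /andP[? ?]; lra.
have G2 : {homo (fun s => s - G s) : x y / x <= y}.
  move=> x y xy; rewrite /G.
  by have := gle _ _ xy; rewrite ler_norml => /andP[? ?]; lra.
have cG : continuous G.
  move=> x; apply: cvgMl; apply: cvgD; first exact: cvg_id.
  by apply: cvgMl; exact: cg.
have [f [intf fE fG]] := monotone_increment_density ab G1 G2 cG.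
have mI : measurable (`]a, b]%classic : set (measurableTypeR R)) by [].
have iI : lebesgue_measure.-integrable `]a, b] (EFin \o f).
  exact: (integrableS measurableT).
have i1 : lebesgue_measure.-integrable (`]a, b] : set R) (EFin \o cst (1 : R)).
  have : lebesgue_measure.-integrable (`[a, b] : set R) (EFin \o cst (1 : R)).
    apply: continuous_compact_integrable; first exact: segment_compact.
    by apply: continuous_subspaceT => x; exact: cvg_cst.
  by apply: integrableS => //; apply: subset_itvr; rewrite bnd_simp.
have i2 : lebesgue_measure.-integrable (`]a, b] : set R) (EFin \o (fun s => 2 * f s)).
  by have := integrableZl mI 2 iI; apply: eq_integrable => // x _; rewrite /= EFinM.
have i3 : lebesgue_measure.-integrable (`]a, b] : set R)
    (EFin \o (fun s => 2 * f s - 1)).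
  exact: (integrableB mI i2 i1).
have i4 : lebesgue_measure.-integrable (`]a, b] : set R)
    (EFin \o (fun s => c * (2 * f s - 1))).
  by have := integrableZl mI c i3; apply: eq_integrable => // x _; rewrite /= EFinM.
have i5 : lebesgue_measure.-integrable (`]a, b[ : set R)
    (EFin \o (Num.norm \o (fun s => c * (2 * f s - 1)))).
  apply: integrableS (integrable_norm i4) => //.
  by apply: subset_itvl; rewrite bnd_simp.
have intE : g b - g a = \int[lebesgue_measure]_(s in `]a, b]) (c * (2 * f s - 1)).
  rewrite RintegralZl// RintegralB// RintegralZl// -fE// Rintegral_cst//.
  rewrite [X in fine X](lebesgue_measure_itv `]a, b])/= lte_fin ab /= /G.
  by field; rewrite gt_eqF.
apply: (@le_trans _ _ (\int[lebesgue_measure]_(s in `]a, b[)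
    `|c * (2 * f s - 1)|%:E)%E).
  rewrite -(@integral_itv_bndoo _ a b _ false false); last first.
    by case/integrableP : i5.
  have fin4 := integrable_fin_num mI (integrable_norm i4).
  rewrite intE -[leRHS](fineK fin4).
  rewrite lee_fin; apply: le_trans (ler_norm _) _.
  exact: le_normr_Rintegral.
apply: ae_ge0_le_integral => //.
- by case/integrableP : i5.
- by apply/measurable_EFinP; apply: measurableT_comp => //; exact: measurable_funTS.
apply: filterS fG; first exact: (ae_filter_ringOfSetsType (@lebesgue_measure R)).
move=> s fs; rewrite /= in_itv/= => /fs[dG <-].
have gE : g = (fun s => c * (2 * G s - s)).
  by apply/funext => x; rewrite /G; field; rewrite gt_eqF.
have dg : is_derive s 1 g (c * (2 * derive1 G s - 1)).
  rewrite gE derive1E; have dG' := derivableP dG.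
  by apply: is_derive_eq; rewrite /GRing.scale/=; ring.
by rewrite lee_fin [derive1 g s]derive1E (@derive_val _ _ _ _ _ _ _ dg).
Qed.

(** * Estimates on intervals and rectangles, and the Jacobi equation *)

(** Cousin's lemma: the supremum of the points that can be reached from [a] is
reached, and it is [b].  It reduces a length estimate along a path to estimates
near each point of the path. *)
Lemma interval_chain (R : realType) (Q : R -> R -> Prop) (a b : R) :
  a <= b ->
  (forall x y z, a <= x -> x <= y -> y <= z -> z <= b -> Q x y -> Q y z -> Q x z) ->
  (forall r, a <= r -> r <= b -> exists2 e, 0 < e &
     forall x y, a <= x -> x <= y -> y <= b -> `|x - r| < e -> `|y - r| < e -> Q x y) ->
  Q a b.
Proof.
move=> ab Qtrans Qloc.
pose S := [set x | a <= x /\ x <= b /\ Q a x].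
have Sa : S a.
  split => //; split => //; have [e e0] := Qloc a (lexx _) ab.
  by apply; rewrite ?subrr ?normr0.
have supS : has_sup S by split; [exists a|exists b => x [_ []]].
have s1 : a <= sup S by exact: ub_le_sup (proj2 supS) _ Sa.
have s2 : sup S <= b by apply: ge_sup; [exists a|move=> x [_ []]].
have [e e0 eQ] := Qloc _ s1 s2.
have [x [ax [xb Qx]] xs] := sup_adherent e0 supS.
have xS : x <= sup S by apply: ub_le_sup (proj2 supS) _ _; split.
have [bs|bs] := leP b (sup S + e / 2).
  apply: (Qtrans _ x) => //; apply: eQ => //.
    by rewrite ltr_norml; apply/andP; split; lra.
  by rewrite ltr_norml; apply/andP; split; lra.
have Sy : S (sup S + e / 2).
  split; first lra; split; first lra.
  apply: (Qtrans _ x) => //; try lra; apply: eQ => //; try lra.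
    by rewrite ltr_norml; apply/andP; split; lra.
  by rewrite ltr_norml; apply/andP; split; lra.
have := ub_le_sup (proj2 supS) Sy; lra.
Qed.

Lemma rectangle_bounded (R : realType) (W : set (R * R)) (f : R * R -> R)
    (x0 x1 y0 y1 : R) :
  (forall u, W u -> {for u, continuous f}) ->
  (forall x y, x0 <= x <= x1 -> y0 <= y <= y1 -> W (x, y)) ->
  exists2 B, 0 < B & forall x y, x0 <= x <= x1 -> y0 <= y <= y1 -> `|f (x, y)| <= B.
Proof.
move=> cf sW; pose K : set (R * R) := `[x0, x1] `*` `[y0, y1].
have cK : compact K by apply: compact_setX; exact: segment_compact.
have cfK : {within K, continuous (fun u => `|f u|)}.
  apply: continuous_in_subspaceT => -[x y]; rewrite inE => -[/=].
  rewrite !in_itv/= => hx hy; apply: cvg_norm; exact/cf/sW.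
have [[u Ku]|K0] := pselect (K !=set0); last first.
  exists 1 => // x y hx hy; exfalso; apply: K0; exists (x, y).
  by split; rewrite /= in_itv.
have [v _ vmax] := compact_EVT_max (ex_intro _ _ Ku) cK cfK.
exists (`|f v| + 1) => [|x y hx hy]; first by rewrite ltr_wpDl.
apply: (le_trans (vmax (x, y) _)); last by rewrite lerDl.
by rewrite inE; split; rewrite /= in_itv.
Qed.

Lemma rectangle_bounded_below (R : realType) (W : set (R * R)) (f : R * R -> R)
    (x0 x1 y0 y1 : R) :
  (forall u, W u -> {for u, continuous f}) ->
  (forall x y, x0 <= x <= x1 -> y0 <= y <= y1 -> W (x, y)) ->
  (forall x y, x0 <= x <= x1 -> y0 <= y <= y1 -> 0 < f (x, y)) ->
  exists2 m, 0 < m & forall x y, x0 <= x <= x1 -> y0 <= y <= y1 -> m <= f (x, y).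
Proof.
move=> cf sW f0; pose K : set (R * R) := `[x0, x1] `*` `[y0, y1].
have cK : compact K by apply: compact_setX; exact: segment_compact.
have cfK : {within K, continuous f}.
  apply: continuous_in_subspaceT => -[x y]; rewrite inE => -[/=].
  rewrite !in_itv/= => hx hy; exact/cf/sW.
have [[u Ku]|K0] := pselect (K !=set0); last first.
  exists 1 => // x y hx hy; exfalso; apply: K0; exists (x, y).
  by split; rewrite /= in_itv.
have [[x' y'] + vmin] := compact_EVT_min (ex_intro _ _ Ku) cK cfK.
rewrite inE => -[/=]; rewrite !in_itv/= => hx' hy'.
exists (f (x', y')) => [|x y hx hy]; first exact: f0.
by apply: vmin; rewrite inE; split; rewrite /= in_itv.
Qed.

Lemma lipschitz_of_derive (R : realType) (f df : R -> R) (B a b : R) :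
  (forall x, a <= x <= b -> is_derive x 1 f (df x)) ->
  (forall x, a <= x <= b -> `|df x| <= B) ->
  forall x y, a <= x <= b -> a <= y <= b -> `|f x - f y| <= B * `|x - y|.
Proof.
move=> fd dB.
suff wl x y : x <= y -> a <= x <= b -> a <= y <= b -> `|f x - f y| <= B * `|x - y|.
  move=> x y hx hy; have [xy|yx] := leP x y; first exact: wl.
  by rewrite distrC (distrC x); apply: wl => //; exact: ltW.
move=> xy /andP[ax xb] /andP[ay yb].
have inab z : z \in `[x, y] -> a <= z <= b.
  by rewrite in_itv/= => /andP[? ?]; apply/andP; split; lra.
have [| |c /inab cab] := @MVT_segment R f df x y xy.
- move=> z zxy; apply/fd/inab; exact: subset_itv_oo_cc zxy.
- apply: derivable_within_continuous => z zxy.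
  by case: (fd z (inab _ zxy)).
rewrite distrC => ->; rewrite normrM (distrC x); apply: ler_wpM2r => //.
exact: dB.
Qed.

Lemma is_derive_d1 (R : realType) (f : R * R -> R) x y :
  derivable (fun x => f (x, y)) x 1 -> is_derive x 1 (fun x => f (x, y)) (d1 f (x, y)).
Proof. by move=> df; rewrite /d1/= derive1E; exact: derivableP. Qed.

Lemma is_derive_d2 (R : realType) (f : R * R -> R) x y :
  derivable (fun y => f (x, y)) y 1 -> is_derive y 1 (fun y => f (x, y)) (d2 f (x, y)).
Proof. by move=> df; rewrite /d2/= derive1E; exact: derivableP. Qed.

Lemma near_sections (R : realType) (W : set (R * R)) x y : open W -> W (x, y) ->
  (\forall x' \near x, W (x', y)) /\ (\forall y' \near y, W (x, y')).
Proof.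
move=> oW Wxy; have nW : nbhs (x, y) W by exact: open_nbhs_nbhs.
split.
  have h1 : x' @[x' --> x] --> x by exact: cvg_id.
  exact: (cvg_pair h1 (cvg_cst y)) nW.
have h1 : y' @[y' --> y] --> y by exact: cvg_id.
exact: (cvg_pair (cvg_cst x) h1) nW.
Qed.

Lemma eq_on_open_d1 (R : realType) (W : set (R * R)) (f g : R * R -> R) :
  open W -> (forall u, W u -> f u = g u) -> forall u, W u -> d1 f u = d1 g u.
Proof.
move=> oW fg [x y] Wu; rewrite /d1 !derive1E; apply: near_eq_derive.
by have [+ _] := near_sections oW Wu; apply: filterS => x' /fg.
Qed.

Lemma eq_on_open_d2 (R : realType) (W : set (R * R)) (f g : R * R -> R) :
  open W -> (forall u, W u -> f u = g u) -> forall u, W u -> d2 f u = d2 g u.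
Proof.
move=> oW fg [x y] Wu; rewrite /d2 !derive1E; apply: near_eq_derive.
by have [_] := near_sections oW Wu; apply: filterS => x' /fg.
Qed.

Lemma partials_cst_on_open (R : realType) (W : set (R * R)) (f : R * R -> R) c :
  open W -> (forall u, W u -> f u = c) -> forall u, W u -> d1 f u = 0 /\ d2 f u = 0.
Proof.
move=> oW fc u Wu; rewrite (eq_on_open_d1 oW (g := cst c) fc)//.
by rewrite (eq_on_open_d2 oW (g := cst c) fc)// /d1 /d2 /= !derive1_cst.
Qed.

(** With [e = h ^+ 2] the right-hand side is [- h_vv / h]; written with [e] it
needs no square root. *)
Lemma brioschi_orthogonal (R : realType) (W : set (R * R)) (e f g : R * R -> R) :
  open W -> (forall u, W u -> 0 < e u) -> (forall u, W u -> f u = 0) ->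
  (forall u, W u -> g u = 1) -> forall u, W u ->
  brioschi e f g u = - d2 (d2 e) u / (2 * e u) + d2 e u ^+ 2 / (4 * e u ^+ 2).
Proof.
move=> oW e0 f0 g1 u Wu.
have f1 v : W v -> d1 f v = 0 by move=> /(partials_cst_on_open oW f0)[].
have f2 v : W v -> d2 f v = 0 by move=> /(partials_cst_on_open oW f0)[].
have g1' v : W v -> d1 g v = 0 by move=> /(partials_cst_on_open oW g1)[].
have g2 v : W v -> d2 g v = 0 by move=> /(partials_cst_on_open oW g1)[].
have [_ f12] := partials_cst_on_open oW f1 Wu.
have [g11 _] := partials_cst_on_open oW g1' Wu.
rewrite /brioschi /det3 f12 g11 f0// g1// f1// f2// g1'// g2//.
by have := e0 _ Wu => e0'; field; rewrite gt_eqF.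
Qed.

(** With [E = h ^+ 2], equality of the curvatures says that [h1] and [h2] solve
the same Jacobi equation [h'' = - K h].  The function [z] below is 4 times the
square of the Wronskian [h1 * h2' - h2 * h1'], hence constant, and it vanishes
at 0.  So the Wronskian vanishes, and [E1 / E2] is constant.  The curvatures are
compared on [`]a, b[] only, where [b] may be 0; the regularity up to [c > 0] is
what makes the initial conditions at 0 usable in that case. *)
Lemma metric_eq_of_curvature_eq (R : realType) (E1 E2 D1 D2 DD1 DD2 : R -> R) (a b c : R) :
  a < 0 -> 0 <= b -> b <= c -> 0 < c ->
  (forall s, a < s < c -> [/\ 0 < E1 s, is_derive s 1 E1 (D1 s) & is_derive s 1 D1 (DD1 s)]) ->
  (forall s, a < s < c -> [/\ 0 < E2 s, is_derive s 1 E2 (D2 s) & is_derive s 1 D2 (DD2 s)]) ->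
  (forall s, a < s < b -> - DD1 s / (2 * E1 s) + D1 s ^+ 2 / (4 * E1 s ^+ 2)
                        = - DD2 s / (2 * E2 s) + D2 s ^+ 2 / (4 * E2 s ^+ 2)) ->
  E1 0 = E2 0 -> D1 0 = 0 -> D2 0 = 0 -> forall s, a < s < b -> E1 s = E2 s.
Proof.
move=> a0 b0 bc c0 H1 H2 Keq E0 D10 D20.
(* 0 may be the right end of the interval on which the derivative vanishes. *)
have cst0 (z : R -> R) : (forall s, a < s < c -> derivable z s 1) ->
    (forall s, a < s < b -> is_derive s 1 z 0) -> forall s, a < s < b -> z s = z 0.
  move=> dz z0 s /andP[as_ sb].
  have [s0|s0|->//] := ltgtP s 0.
  - have [| |x _] := @MVT R z (fun=> 0) s 0 s0.
    + by move=> x; rewrite in_itv/= => /andP[? ?]; apply: z0; apply/andP; split; lra.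
    + apply: derivable_within_continuous => x; rewrite in_itv/= => /andP[? ?].
      by apply: dz; apply/andP; split; lra.
    by rewrite mul0r => /eqP; rewrite subr_eq0 => /eqP.
  - have [| |x _] := @MVT R z (fun=> 0) 0 s s0.
    + by move=> x; rewrite in_itv/= => /andP[? ?]; apply: z0; apply/andP; split; lra.
    + apply: derivable_within_continuous => x; rewrite in_itv/= => /andP[? ?].
      by apply: dz; apply/andP; split; lra.
    by rewrite mul0r => /eqP; rewrite subr_eq0 => /eqP.
pose q s := E1 s * D2 s - E2 s * D1 s.
pose z s := q s ^+ 2 * (E1 s * E2 s)^-1.
have dz s : a < s < c -> is_derive s 1 z
  ((2 * q s * (E1 s * DD2 s - E2 s * DD1 s) * (E1 s * E2 s)
    - q s ^+ 2 * (D1 s * E2 s + E1 s * D2 s)) / (E1 s * E2 s) ^+ 2).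
  move=> sI; have [e1 ? ?] := H1 _ sI; have [e2 ? ?] := H2 _ sI.
  have n0 : E1 s * E2 s != 0 by rewrite mulf_neq0// gt_eqF.
  rewrite /z /q; apply: is_derive_eq.
  rewrite /GRing.scale/=; field.
  by rewrite !gt_eqF.
have dz0 s : a < s < b -> is_derive s 1 z 0.
  move=> /andP[as_ sb]; have sI : a < s < c by apply/andP; split; lra.
  have [e1 _ _] := H1 _ sI; have [e2 _ _] := H2 _ sI.
  have := dz s sI; set x := (X in is_derive _ _ _ X); suff -> : x = 0 by [].
  have /Keq K : a < s < b by apply/andP.
  (* The equality of the curvatures, solved for the second derivative of [E2]. *)
  have DD2E : DD2 s = D2 s ^+ 2 / (2 * E2 s) + DD1 s * E2 s / E1 s
      - D1 s ^+ 2 * E2 s / (2 * E1 s ^+ 2).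
    have -> : DD2 s = - (2 * E2 s) * (- DD2 s / (2 * E2 s) + D2 s ^+ 2 / (4 * E2 s ^+ 2))
        + D2 s ^+ 2 / (2 * E2 s).
      by field; rewrite gt_eqF.
    by rewrite -K; field; rewrite !gt_eqF.
  rewrite /x DD2E /q; field.
  by rewrite !gt_eqF.
have q0 s : a < s < b -> q s = 0.
  move=> sI; have /andP[as_ sb] := sI; have sI' : a < s < c by apply/andP; split; lra.
  have [e1 _ _] := H1 _ sI'; have [e2 _ _] := H2 _ sI'.
  have dz' r : a < r < c -> derivable z r 1 by move=> /dz[].
  have := cst0 z dz' dz0 s sI.
  rewrite {2}/z /q D10 D20 !mulr0 subrr expr0n mul0r => /eqP.
  rewrite mulf_eq0 invr_eq0 (mulf_eq0 (E1 s)) (gt_eqF e1) (gt_eqF e2) !orbF.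
  by rewrite sqrf_eq0 => /eqP.
pose w s := E1 s * (E2 s)^-1.
have dw s : a < s < c -> is_derive s 1 w (- q s / E2 s ^+ 2).
  move=> sI; have [e1 ? ?] := H1 _ sI; have [e2 ? ?] := H2 _ sI.
  have n0 : E2 s != 0 by rewrite gt_eqF.
  rewrite /w /q; apply: is_derive_eq.
  by rewrite /GRing.scale/=; field.
move=> s sI; have /andP[as_ sb] := sI; have sI' : a < s < c by apply/andP; split; lra.
have [e1 _ _] := H1 _ sI'; have [e2 _ _] := H2 _ sI'.
have : w s = w 0.
  apply: cst0 sI => [x /dw[]//|x xI].
  have /andP[ax xb] := xI.
  have /dw : a < x < c by apply/andP; split; lra.
  by rewrite q0// oppr0 mul0r.
have I0 : a < 0 < c by rewrite a0.
have [e0 _ _] := H2 _ I0.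
rewrite /w E0 divff ?gt_eqF// => w1.
by rewrite -[LHS](@divfK _ (E2 s)) ?gt_eqF// w1 mul1r.
Qed.

(** * The metric in Fermi coordinates *)

Lemma open_rectangle (R : realType) (x0 x1 y0 y1 : R) :
  open (`]x0, x1[ `*` `]y0, y1[ : set (R * R)).
Proof.
rewrite openE => -[x y] [/= xI yI].
exists (`]x0, x1[%classic, `]y0, y1[%classic) => //=.
by split; apply: open_nbhs_nbhs; split => //; exact: interval_open.
Qed.

Lemma smooth_on_C1 (R : realType) (W : set (R * R)) (f : R * R -> R) :
  smooth_on W f ->
  [/\ forall u, W u -> {for u, continuous f},
      forall u, W u -> {for u, continuous (d1 f)},
      forall x y, W (x, y) -> is_derive x 1 (fun x => f (x, y)) (d1 f (x, y)),
      forall x y, W (x, y) -> is_derive y 1 (fun y => f (x, y)) (d2 f (x, y)) &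
      forall x y, W (x, y) ->
        is_derive y 1 (fun y => d2 f (x, y)) (d2 (d2 f) (x, y))].
Proof.
move=> /(_ 2%N) [cf [dx dy [cd1 _] [_ [_ ddy _ _]]]]; split.
- exact: cf.
- exact: cd1.
- by move=> x y Wxy; apply: is_derive_d1; exact: dx Wxy.
- by move=> x y Wxy; apply: is_derive_d2; exact: dy Wxy.
- by move=> x y Wxy; apply: is_derive_d2; exact: ddy Wxy.
Qed.

(** In a Fermi chart, the geodesic equation of the lines [s |-> psi (t, s)] says
that [F] is constant along them, so that [F = 0]; the geodesic equation of the
baseline says that the normal derivative of [E] vanishes on it. *)
Lemma fermi_first_form (R : realType) (S : surface R) (l a : R) (psi : R * R -> S) :
  a < 0 -> fermi_coordinates l a psi ->
  exists2 eps, 0 < eps & let W := (`]- eps, l + eps[ `*` `]a, - a[ : set (R * R)) in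
    [/\ chart W psi,
        (forall u, W u -> gF psi u = 0),
        (forall u, W u -> gG psi u = 1) &
        forall t, - eps < t < l + eps -> gE psi (t, 0) = 1 /\ d2 (gE psi) (t, 0) = 0].
Proof.
move=> a0 [eps eps0 [ch base perp]]; exists eps => //= .
set W := (`]- eps, l + eps[ `*` `]a, - a[) in ch *.
have oW : open W by exact: open_rectangle.
have WP t s : W (t, s) <-> (- eps < t < l + eps /\ a < s < - a).
  by rewrite /W; split => -[/=]; rewrite !in_itv.
have zI : a < 0 < - a by rewrite a0 oppr_gt0.
have gG1 u : W u -> gG psi u = 1.
  by case: u => t s /WP[tI sI]; have [] := perp _ _ tI sI.
have gF_derive t s : W (t, s) -> is_derive s 1 (fun r => gF psi (t, r)) 0.
  move=> Wts; have /WP[tI sI] := Wts.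
  have [[_ geo] _] := perp _ _ tI sI.
  have [] := geo W psi (fun r => (t, r)) ch.
    have [_] := near_sections oW Wts.
    by apply: filterS.
  have -> : fst \o (fun r : R => (t, r)) = cst t by [].
  have -> : snd \o (fun r : R => (t, r)) = id by [].
  have -> : derive1 (cst t) = cst (0 : R) by apply/funext => x; rewrite derive1_cst.
  have -> : derive1 (id : R -> R) = cst (1 : R).
    by apply/funext => x; rewrite derive1E derive_id.
  have [gG0 _] := partials_cst_on_open oW gG1 Wts.
  rewrite /cst gG0 !expr0n !mulr0 !mul0r !add0r expr1n mulr1 mul0r => _ + _.
  by rewrite (_ : (fun r => _) = (fun r => gF psi (t, r)))//; apply/funext => r;
    rewrite mulr0 add0r mulr1.
have gF0 u : W u -> gF psi u = 0.
  case: u => t s Wts; have /WP[tI sI] := Wts.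
  have [_ _ gF00] := base _ tI.
  have := @lipschitz_of_derive R (fun r => gF psi (t, r)) (cst 0) 0
    (Num.min s 0) (Num.max s 0).
  have inI x : Num.min s 0 <= x <= Num.max s 0 -> W (t, x).
    move=> xI; apply/WP; split => //; move: xI sI zI.
    rewrite ge_min le_max => /andP[/orP[?|?] /orP[?|?]] /andP[? ?] /andP[? ?];
      apply/andP; split; lra.
  move=> /(_ (fun x xI => gF_derive _ _ (inI x xI))).
  have n0 x : Num.min s 0 <= x <= Num.max s 0 -> `|cst (0 : R) x| <= 0.
    by rewrite normr0.
  move=> /(_ n0 s 0); rewrite !ge_min !le_max !lexx !orbT /= => /(_ isT isT).
  by rewrite gF00 subr0 mul0r normr_le0 => /eqP.
split => // t tI; have [geo gE1 _] := base _ tI; split => //.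
have W0 : W (t, 0) by apply/WP.
have [_ geo'] := geo.
have nW : \forall r \near t, W (r, 0) /\ psi (r, 0) = psi (r, 0).
  by have [+ _] := near_sections oW W0; apply: filterS.
have := geo' W psi (fun r => (r, 0)) ch nW.
have -> : fst \o (fun r : R => (r, (0 : R))) = id by [].
have -> : snd \o (fun r : R => (r, (0 : R))) = cst 0 by [].
have -> : derive1 (cst (0 : R)) = cst (0 : R).
  by apply/funext => x; rewrite derive1_cst.
have -> : derive1 (id : R -> R) = cst (1 : R).
  by apply/funext => x; rewrite derive1E derive_id.
move=> [_ _]; rewrite /cst !expr0n !mulr0 !addr0 expr1n mulr1 => gFd.
have : is_derive t 1 (fun r => gF psi (r, 0) * 1 + gG psi (r, 0) * 0) 0.
  apply: near_eq_is_derive (is_derive_cst 0 t 1).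
  have [+ _] := near_sections oW W0; apply: filterS => r Wr.
  by rewrite gF0// mulr0 mul0r addr0.
move=> [_ d0]; have [_] := gFd; rewrite d0 => /esym/eqP.
by rewrite mulf_eq0 invr_eq0 pnatr_eq0 orbF => /eqP.
Qed.

Section profile.
Variables (R : realType) (S : surface R) (l a b : R) (psi : R * R -> S).
Hypotheses (hl : 0 < l) (hab : a < 0 <= b) (hba : `|b| <= `|a|).

Let ba : b <= - a.
Proof.
have /andP[a0 b0] := hab.
by move: hba; rewrite ger0_norm// ltr0_norm.
Qed.

Lemma same_curvature_same_profile eps (W := `]- eps, l + eps[ `*` `]a, - a[) t t' :
  chart W psi -> (forall u, W u -> gF psi u = 0) -> (forall u, W u -> gG psi u = 1) ->
  (forall t, - eps < t < l + eps -> gE psi (t, 0) = 1 /\ d2 (gE psi) (t, 0) = 0) ->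
  - eps < t < l + eps -> - eps < t' < l + eps ->
  (forall s, a < s < b -> brioschi (gE psi) (gF psi) (gG psi) (t, s)
                        = brioschi (gE psi) (gF psi) (gG psi) (t', s)) ->
  forall s, a < s < b -> gE psi (t, s) = gE psi (t', s).
Proof.
move=> ch gF0 gG1 base tI tI' curv; have /andP[a0 b0] := hab.
have oW : open W by exact: open_rectangle.
have WP t1 s : - eps < t1 < l + eps -> a < s < - a -> W (t1, s).
  by move=> ? ?; split; rewrite /= in_itv.
have gE0 u : W u -> 0 < gE psi u by move=> Wu; have [] := metric_pos ch Wu.
have [sE _ _] := metric_smooth ch.
have [_ _ _ dE ddE] := smooth_on_C1 sE.
apply: (@metric_eq_of_curvature_eq R (fun s => gE psi (t, s)) (fun s => gE psi (t', s))
  (fun s => d2 (gE psi) (t, s)) (fun s => d2 (gE psi) (t', s))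
  (fun s => d2 (d2 (gE psi)) (t, s)) (fun s => d2 (d2 (gE psi)) (t', s)) a b (- a) a0 b0 ba).
- by rewrite oppr_gt0.
- by move=> s sI; have Wts := WP _ _ tI sI; split; [exact: gE0|exact: dE|exact: ddE].
- by move=> s sI; have Wts := WP _ _ tI' sI; split; [exact: gE0|exact: dE|exact: ddE].
- move=> s /[dup] /curv + /andP[as_ sb].
  have sI : a < s < - a by rewrite as_ (lt_le_trans sb).
  have curvE := brioschi_orthogonal oW gE0 gF0 gG1.
  by rewrite (curvE _ (WP _ _ tI sI)) (curvE _ (WP _ _ tI' sI)).
- by rewrite (base _ tI).1 (base _ tI').1.
- by have [] := base _ tI.
- by have [] := base _ tI'.
Qed.

(** The chart [M \o psi] has the same coefficients as [psi] and shows the point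
[psi (l, s)] at the parameter [(0, s)].  So the curvatures of [psi] at [(0, s)]
and at [(l, s)] both are the curvature of the surface at [psi (l, s)]. *)
Lemma isometric_sides_same_profile (kappa : S -> R) (M : S -> S) eps
    (W := `]- eps, l + eps[ `*` `]a, - a[) :
  0 < eps -> gauss_curvature kappa -> gluing l a b psi M ->
  chart W psi -> (forall u, W u -> gF psi u = 0) -> (forall u, W u -> gG psi u = 1) ->
  (forall t, - eps < t < l + eps -> gE psi (t, 0) = 1 /\ d2 (gE psi) (t, 0) = 0) ->
  forall s, a < s < b -> gE psi (0, s) = gE psi (l, s).
Proof.
move=> eps0 curv [[_ isoM] glue] ch gF0 gG1 base; have /andP[a0 b0] := hab.
have oW : open W by exact: open_rectangle.
have I0 : - eps < 0 < l + eps by rewrite oppr_lt0 eps0 addr_gt0.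
have Il : - eps < l < l + eps by apply/andP; split; lra.
have WP t1 s : - eps < t1 < l + eps -> a < s < - a -> W (t1, s).
  by move=> ? ?; split; rewrite /= in_itv.
have gE0 u : W u -> 0 < gE psi u by move=> Wu; have [] := metric_pos ch Wu.
have [chM eqM] := isoM _ _ ch.
have eqE u : W u -> gE (M \o psi) u = gE psi u by move=> /eqM[].
apply: (@same_curvature_same_profile eps) => // s sI.
have sI' : a < s < - a by case/andP: sI => as_ sb; rewrite as_ (lt_le_trans sb).
have W0 := WP _ _ I0 sI'; have Wl := WP _ _ Il sI'.
rewrite (curv _ _ _ ch Wl) -glue// -[M _]/((M \o psi) (0, s)) -(curv _ _ _ chM W0).
have gE0' u : W u -> 0 < gE (M \o psi) u by move=> Wu; rewrite eqE//; exact: gE0.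
have gF0' u : W u -> gF (M \o psi) u = 0.
  by move=> Wu; have [_ -> _] := eqM _ Wu; exact: gF0.
have gG1' u : W u -> gG (M \o psi) u = 1.
  by move=> Wu; have [_ _ ->] := eqM _ Wu; exact: gG1.
rewrite (brioschi_orthogonal oW gE0 gF0 gG1 W0).
rewrite (brioschi_orthogonal oW gE0' gF0' gG1' W0) (eqE _ W0).
rewrite (eq_on_open_d2 oW eqE W0).
by rewrite (eq_on_open_d2 oW (eq_on_open_d2 oW eqE) W0).
Qed.

End profile.

(** * Paths and distances on the cylinder *)

Lemma Rintegral_itv_cat (R : realType) (f : R -> R) (x y z : R) :
  x <= y -> y <= z -> lebesgue_measure.-integrable `[x, z] (EFin \o f) ->
  \int[lebesgue_measure]_(t in `[x, y]) f t + \int[lebesgue_measure]_(t in `[y, z]) f t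
  = \int[lebesgue_measure]_(t in `[x, z]) f t.
Proof.
move=> xy yz intf; rewrite -(Rintegral_itv_obnd_cbnd (r := y)); last first.
  by apply: integrableS intf => //; apply: subset_itvr; rewrite bnd_simp.
rewrite -(@Rintegral_itvB R f (BLeft x) (BRight z) y intf) ?bnd_simp//.
by rewrite addrC subrK.
Qed.

Lemma continuous_on_segment_integrable (R : realType) (f : R -> R) (x y : R) :
  (forall r, x <= r <= y -> {for r, continuous f}) ->
  lebesgue_measure.-integrable `[x, y] (EFin \o f).
Proof.
move=> cf; apply: continuous_compact_integrable; first exact: segment_compact.
by apply: continuous_in_subspaceT => r; rewrite inE/= in_itv/=; exact: cf.
Qed.

Lemma C1_increment_le (R : realType) (u : R -> R) (x y : R) :
  (forall t, derivable u t 1) -> continuous (derive1 u) -> x <= y ->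
  `|u y - u x| <= \int[lebesgue_measure]_(t in `[x, y]) `|derive1 u t|.
Proof.
move=> du cu; rewrite le_eqVlt => /predU1P[<-|xy].
  by rewrite subrr normr0; apply: Rintegral_ge0.
have cu' t : {for t, continuous u} by apply/differentiable_continuous/derivable1_diffP.
have int_u : lebesgue_measure.-integrable `[x, y] (EFin \o derive1 u).
  by apply: continuous_on_segment_integrable => r _; exact: cu.
have -> : u y - u x = \int[lebesgue_measure]_(t in `[x, y]) derive1 u t.
  rewrite /Rintegral (@continuous_FTC2 R (derive1 u) u x y xy) -?EFinB//.
    by apply: continuous_in_subspaceT => r _; exact: cu.
  split=> [r _//||]; apply: cvg_within_filter; exact: cu'.
exact: le_normr_Rintegral.
Qed.

Section cylinder.
Variables (R : realType) (S : surface R) (l a b eps : R) (psi : R * R -> S)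
  (M : S -> S) (h : R -> R -> R).
Let W : set (R * R) := `]- eps, l + eps[ `*` `]a, - a[.
Hypotheses (eps0 : 0 < eps) (ba : b <= - a) (hh : fermi_metric l a b psi h).

Lemma strip_domP t s : strip_dom l a b (t, s) <-> 0 <= t <= l /\ a < s < b.
Proof. by rewrite /strip_dom; split => -[/=]; rewrite !in_itv/=. Qed.

Lemma strip_dom_chart : strip_dom l a b `<=` W.
Proof.
move=> [t s] /strip_domP[/andP[t0 tl] /andP[as_ sb]]; split; rewrite /= in_itv/=.
  by rewrite (lt_le_trans _ t0) ?oppr_lt0// (le_lt_trans tl) ?ltrDl.
by rewrite as_ (lt_le_trans sb).
Qed.

(** The integrand of [curve_length]. *)
Definition speed (c : R -> R * R) (t : R) : R :=
  Num.sqrt (gE psi (c t) * derive1 (fst \o c) t ^+ 2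
    + 2 * gF psi (c t) * derive1 (fst \o c) t * derive1 (snd \o c) t
    + gG psi (c t) * derive1 (snd \o c) t ^+ 2).

Lemma speedE c t : strip_dom l a b (c t) ->
  speed c t = Num.sqrt ((h (c t).1 (c t).2 * derive1 (fst \o c) t) ^+ 2
                        + derive1 (snd \o c) t ^+ 2).
Proof.
rewrite {1}(surjective_pairing (c t)) => /hh[_ eE eF eG].
by rewrite /speed (surjective_pairing (c t)) /= eE eF eG exprMn mulr0 !mul0r addr0 mul1r.
Qed.

Lemma cyl_path_length_ge0 p q L : cyl_path_length l a b psi M p q L -> 0 <= L.
Proof.
elim=> // [c _ _|p' q' r L1 L2 _ L10 _ L20]; last exact: addr_ge0.
by apply: Rintegral_ge0 => t _; exact: sqrtr_ge0.
Qed.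

Lemma cyl_dist_le p q L : cyl_path_length l a b psi M p q L ->
  cyl_dist l a b psi M p q <= L.
Proof.
by move=> pqL; apply: ge_inf => //; exists 0 => L'; exact: cyl_path_length_ge0.
Qed.

Definition segment (u v : R * R) (r : R) : R * R :=
  (u.1 + r * (v.1 - u.1), u.2 + r * (v.2 - u.2)).

Lemma derive_affine (x y r : R) : is_derive r 1 (fun r => x + r * (y - x)) (y - x).
Proof. by apply: is_derive_eq; rewrite /GRing.scale/=; ring. Qed.

Lemma segment_C1 u v : C1_curve (segment u v).
Proof.
have E (x y : R) : derive1 (fun r => x + r * (y - x)) = cst (y - x).
  by apply/funext => r; rewrite derive1E; have [_ ->] := derive_affine x y r.
split.
- by move=> t; have [] := derive_affine u.1 v.1 t.
- by move=> t; have [] := derive_affine u.2 v.2 t.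
- by rewrite (E u.1 v.1) => t; exact: cvg_cst.
- by rewrite (E u.2 v.2) => t; exact: cvg_cst.
Qed.

Lemma segment_between (x y m n r : R) : m <= x <= n -> m <= y <= n -> 0 <= r <= 1 ->
  m <= x + r * (y - x) <= n.
Proof.
move=> /andP[mx xn] /andP[my yn] /andP[r0 r1].
have -> : x + r * (y - x) = (1 - r) * x + r * y by ring.
have r1' : 0 <= 1 - r by rewrite subr_ge0.
apply/andP; split.
  have -> : m = (1 - r) * m + r * m by ring.
  by rewrite lerD// ler_wpM2l.
have -> : n = (1 - r) * n + r * n by ring.
by rewrite lerD// ler_wpM2l.
Qed.

Lemma segment_strip u v r : strip_dom l a b u -> strip_dom l a b v -> 0 <= r <= 1 ->
  strip_dom l a b (segment u v r).
Proof.
case: u v => [t s] [t' s'] /strip_domP[tI /andP[as_ sb]] /strip_domP[tI' /andP[as' sb']] r01.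
apply/strip_domP; split; first exact: segment_between.
have := @segment_between s s' (Num.min s s') (Num.max s s') r.
rewrite !ge_min !le_max !lexx !orbT => /(_ isT isT r01) /andP[h1 h2] /=.
apply/andP; split.
  by case/orP: h1; exact: lt_le_trans.
by case/orP: h2 => /le_lt_trans; apply.
Qed.

Lemma cyl_path_segment u v : strip_dom l a b u -> strip_dom l a b v ->
  cyl_path_length l a b psi M (psi u) (psi v) (curve_length psi (segment u v)).
Proof.
move=> su sv; have := @cyl_piece R S l a b psi M (segment u v) (segment_C1 u v).
rewrite {2 3}/segment !mul0r !mul1r !addr0 (addrC u.1) subrK (addrC u.2) subrK.
rewrite -!surjective_pairing; apply => t; exact: segment_strip.
Qed.

Lemma curve_length_segment_le u v B : strip_dom l a b u -> strip_dom l a b v -> 0 <= B ->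
  (forall r, 0 <= r <= 1 -> h (segment u v r).1 (segment u v r).2 <= B) ->
  curve_length psi (segment u v) <= B * `|v.1 - u.1| + `|v.2 - u.2|.
Proof.
move=> su sv B0 hB; set C := _ + _.
have E (x y : R) r : derive1 (fun r => x + r * (y - x)) r = y - x.
  by rewrite derive1E; have [_ ->] := derive_affine x y r.
have C0 : 0 <= C by rewrite addr_ge0// mulr_ge0.
have leC r : 0 <= r <= 1 -> speed (segment u v) r <= C.
  move=> r01; have sr := segment_strip su sv r01.
  rewrite speedE// (E u.1 v.1) (E u.2 v.2) -(ger0_norm C0) -sqrtr_sqr ler_sqrt ?sqr_ge0//.
  have h0 : 0 < h (segment u v r).1 (segment u v r).2.
    by move: sr; rewrite {1}(surjective_pairing (segment u v r)) => /hh[].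
  rewrite exprMn -(real_normK (num_real (v.1 - u.1))) -(real_normK (num_real (v.2 - u.2))).
  have hb := hB _ r01; rewrite /C; set x := `|v.1 - _|; set y := `|v.2 - _|.
  have x0 : 0 <= x by exact: normr_ge0.
  have y0 : 0 <= y by exact: normr_ge0.
  rewrite sqrrD exprMn; apply: lerD => //; apply: ler_wpDr.
    by rewrite mulrn_wge0// !mulr_ge0.
  rewrite ler_wpM2r ?sqr_ge0//.
  by rewrite ler_pXn2r// nnegrE// ltW.
have le1 : (\int[lebesgue_measure]_(r in `[0%R, 1%R]) (speed (segment u v) r)%:E <= C%:E)%E.
  apply: (@le_trans _ _ (\int[lebesgue_measure]_(r in `[0%R, 1%R]) cst C%:E r)%E).
    apply: ge0_le_integral_lower => r; first by rewrite lee_fin sqrtr_ge0.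
    by rewrite /= in_itv/= lee_fin; exact: leC.
  rewrite integral_cst// [X in (_ * X)%E](lebesgue_measure_itv `[0, 1])/= lte_fin ltr01.
  by rewrite -EFinB subr0 mule1.
rewrite -lee_fin; apply: (le_trans _ le1).
rewrite [leLHS](_ : _ =
  (\int[lebesgue_measure]_(r in `[0%R, 1%R]) (speed (segment u v) r)%:E)%E)//.
rewrite /curve_length /Rintegral fineK// ge0_fin_numE; last first.
  by apply: integral_ge0 => r _; rewrite lee_fin sqrtr_ge0.
by apply: le_lt_trans le1 _; rewrite ltry.
Qed.

Lemma cyl_dist_segment_le u v B : strip_dom l a b u -> strip_dom l a b v -> 0 <= B ->
  (forall r, 0 <= r <= 1 -> h (segment u v r).1 (segment u v r).2 <= B) ->
  cyl_dist l a b psi M (psi u) (psi v) <= B * `|v.1 - u.1| + `|v.2 - u.2|.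
Proof.
move=> su sv B0 hB; apply: le_trans (curve_length_segment_le su sv B0 hB).
by apply: cyl_dist_le; exact: cyl_path_segment.
Qed.

End cylinder.

Section path_lipschitz.
Variables (R : realType) (S : surface R) (l a b eps : R) (psi : R * R -> S)
  (M : S -> S) (h : R -> R -> R).
Let W : set (R * R) := `]- eps, l + eps[ `*` `]a, - a[.
Hypotheses (hl : 0 < l) (eps0 : 0 < eps) (ba : b <= - a).
Hypotheses (ch : chart W psi) (hh : fermi_metric l a b psi h).
Hypothesis glue : forall s, a < s < b -> M (psi (0, s)) = psi (l, s).

Lemma speed_continuous c r : C1_curve c -> W (c r) -> {for r, continuous (speed psi c)}.
Proof.
move=> [du dv cdu cdv] Wc.
have [sE sF sG] := metric_smooth ch.
have cE : {for c r, continuous (gE psi)} by have [+ _ _ _ _] := smooth_on_C1 sE; apply.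
have cF : {for c r, continuous (gF psi)} by have [+ _ _ _ _] := smooth_on_C1 sF; apply.
have cG : {for c r, continuous (gG psi)} by have [+ _ _ _ _] := smooth_on_C1 sG; apply.
have cc : {for r, continuous c}.
  have cu : {for r, continuous (fst \o c)} by apply/differentiable_continuous/derivable1_diffP.
  have cv : {for r, continuous (snd \o c)} by apply/differentiable_continuous/derivable1_diffP.
  have e : c = (fun x => ((fst \o c) x, (snd \o c) x)).
    by apply/funext => x /=; case: (c x).
  by rewrite e; exact: (cvg_pair cu cv).
have cu : {for r, continuous (derive1 (fst \o c))} by exact: cdu.
have cv : {for r, continuous (derive1 (snd \o c))} by exact: cdv.
apply: (@continuous_comp _ _ _ _ Num.sqrt); last exact: sqrt_continuous.
apply: cvgD; [apply: cvgD|].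
- apply: cvgM; first exact: (@continuous_comp _ _ _ c (gE psi)).
  exact: (cvgM cu cu).
- apply: cvgM => //; apply: cvgM => //; apply: cvgMr.
  exact: (@continuous_comp _ _ _ c (gF psi)).
- apply: cvgM; first exact: (@continuous_comp _ _ _ c (gG psi)).
  exact: (cvgM cv cv).
Qed.

Lemma metric_bounds c' d' : a < c' -> d' < b ->
  exists m B, [/\ 0 < m, 0 < B &
    forall t s, 0 <= t <= l -> c' <= s <= d' -> m <= h t s <= B].
Proof.
move=> ac db.
have [sE _ _] := metric_smooth ch.
have [cE _ _ _ _] := smooth_on_C1 sE.
have sdom t s : 0 <= t <= l -> c' <= s <= d' -> strip_dom l a b (t, s).
  move=> tI /andP[cs sd]; apply/strip_domP; split => //.
  by rewrite (lt_le_trans ac)//= (le_lt_trans sd).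
have sW t s : 0 <= t <= l -> c' <= s <= d' -> W (t, s).
  by move=> tI sI; apply: (strip_dom_chart eps0 ba); exact: sdom.
have [|m m0 mE] := rectangle_bounded_below cE sW.
  by move=> t s tI sI; have [h0 -> _ _] := hh (sdom _ _ tI sI); exact: exprn_gt0.
have [B B0 BE] := rectangle_bounded cE sW.
exists (Num.sqrt m), (Num.sqrt B); split; rewrite ?sqrtr_gt0// => t s tI sI.
have := mE _ _ tI sI; have := BE _ _ tI sI; have [h0 -> _ _] := hh (sdom _ _ tI sI).
rewrite ger0_norm ?sqr_ge0// => hB mh.
have hE : h t s = Num.sqrt (h t s ^+ 2) by rewrite sqrtr_sqr ger0_norm// ltW.
have B0' := ltW B0.
by rewrite hE !ler_sqrt ?sqr_ge0// mh.
Qed.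

(** Near the ends of the strip [h] may tend to 0, and lengths do not control the
variation of [t] there; but there [f] is constant.  Elsewhere [h] is bounded
below, and Euclidean lengths are bounded by a multiple of Riemannian ones.  So
the estimate holds near each point of a path, and [interval_chain] globalizes
it. *)
Lemma path_lipschitz (F : S -> R) (f : R * R -> R) (c0 d0 Lf : R) :
  a < c0 -> d0 < b -> 0 <= Lf ->
  (forall u, strip_dom l a b u -> F (psi u) = f u) ->
  (forall t s t' s', 0 <= t <= l -> 0 <= t' <= l ->
     `|f (t, s) - f (t', s')| <= Lf * (`|t - t'| + `|s - s'|)) ->
  (forall t s, 0 <= t <= l -> s <= c0 -> f (t, s) = 0) ->
  (forall t s, 0 <= t <= l -> d0 <= s -> f (t, s) = 1) ->
  (forall s, a < s < b -> f (0, s) = f (l, s)) ->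
  exists2 k, 0 <= k & forall p q L, cyl_path_length l a b psi M p q L ->
    `|F p - F q| <= k * L.
Proof.
move=> ac db Lf0 Ff fL f0 f1 fper.
(* The metric is bounded below on the lines [c' <= s <= d'], and [f] is constant
   beyond [c0] and [d0]; the two regimes overlap. *)
pose c' := (a + c0) / 2; pose d' := (d0 + b) / 2.
have [m [B [m0 _ mh]]] : exists m B, [/\ 0 < m, 0 < B &
    forall t s, 0 <= t <= l -> c' <= s <= d' -> m <= h t s <= B].
  by apply: metric_bounds; rewrite /c' /d'; lra.
pose k := Lf * (m^-1 + 1).
have k0 : 0 <= k by rewrite mulr_ge0// addr_ge0// invr_ge0 ltW.
exists k => // p q L; elim => [c C1c cS|s sI|s sI|p' q' r L1 L2 _ IH1 _ IH2]; last first.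
- rewrite mulrDr; apply: le_trans (lerD IH1 IH2).
  by rewrite -(subrKA (F q')) ler_normD.
- rewrite glue// !Ff ?fper ?subrr ?normr0 ?mulr0//.
    by apply/strip_domP; split => //; rewrite lexx ltW.
  by apply/strip_domP; split => //; rewrite lexx ltW.
- rewrite glue// !Ff ?fper ?subrr ?normr0 ?mulr0//.
    by apply/strip_domP; split => //; rewrite lexx ltW.
  by apply/strip_domP; split => //; rewrite lexx ltW.
have cW r : 0 <= r <= 1 -> W (c r) by move=> /cS; exact: strip_dom_chart.
have ispeed x y : 0 <= x -> y <= 1 ->
    lebesgue_measure.-integrable `[x, y] (EFin \o speed psi c).
  move=> x0 y1; apply: continuous_on_segment_integrable => r /andP[xr ry].
  by apply: speed_continuous => //; apply: cW; rewrite (le_trans x0)// (le_trans ry).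
pose Q x y := `|f (c x) - f (c y)| <= k * \int[lebesgue_measure]_(t in `[x, y]) speed psi c t.
have speed0 t : 0 <= speed psi c t by exact: sqrtr_ge0.
suff : Q 0 1 by rewrite !Ff//; apply: cS; rewrite lexx ler01.
apply: (@interval_chain R Q) => // [x y z x0 xy yz z1 Qxy Qyz|r r0 r1].
  rewrite /Q -(Rintegral_itv_cat xy yz (ispeed _ _ x0 z1)) mulrDr.
  by apply: le_trans (lerD Qxy Qyz); rewrite -(subrKA (f (c y))) ler_normD.
have [du dv cdu cdv] := C1c.
have ct t : 0 <= t <= 1 -> 0 <= (c t).1 <= l.
  by move=> /cS; rewrite (surjective_pairing (c t)) => /strip_domP[].
have cv2 : {for r, continuous (snd \o c)} by apply/differentiable_continuous/derivable1_diffP.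
have sub01 (x y t : R) : 0 <= x -> y <= 1 -> x <= t <= y -> 0 <= t <= 1.
  by move=> x0 y1 /andP[xt ty]; rewrite (le_trans x0)//= (le_trans ty).
have Qconst v : (\forall t \near r, 0 <= t <= 1 -> f (c t) = v) ->
    exists2 e, 0 < e & forall x y, 0 <= x -> x <= y -> y <= 1 ->
      `|x - r| < e -> `|y - r| < e -> Q x y.
  move=> /nbhs_ballP[e /= e0 eP]; exists e => // x y x0 xy y1 xr yr.
  have fx : f (c x) = v by apply: eP; rewrite /ball/= ?x0 ?(le_trans xy)// distrC.
  have fy : f (c y) = v by apply: eP; rewrite /ball/= ?y1 ?(le_trans x0)// distrC.
  rewrite /Q fx fy subrr normr0 mulr_ge0//.
  by apply: Rintegral_ge0 => t _; exact: speed0.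
have [clow|chigh] := ltP (c r).2 c0.
  apply: (Qconst 0).
  have : \forall t \near r, (snd \o c) t < c0 by apply: cvgr_lt cv2 _ _.
  apply: filterS => t tc0 t01; rewrite (surjective_pairing (c t)) f0 ?ct//.
  exact: ltW.
have [dhigh|dlow] := ltP d0 (c r).2.
  apply: (Qconst 1).
  have : \forall t \near r, d0 < (snd \o c) t by apply: cvgr_gt cv2 _ _.
  apply: filterS => t tc0 t01; rewrite (surjective_pairing (c t)) f1 ?ct//.
  exact: ltW.
have : \forall t \near r, c' <= (c t).2 <= d'.
  have n1 : \forall t \near r, c' < (snd \o c) t.
    by apply: cvgr_gt cv2 _ _; rewrite /c' /=; lra.
  have n2 : \forall t \near r, (snd \o c) t < d'.
    by apply: cvgr_lt cv2 _ _; rewrite /d' /=; lra.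
  by apply: filterS2 n1 n2 => t /= /ltW -> /ltW ->.
move=> /nbhs_ballP[e /= e0 eP]; exists e => // x y x0 xy y1 xr yr.
have inball t : x <= t <= y -> c' <= (c t).2 <= d'.
  move=> /andP[xt ty]; apply: eP; move: xr yr.
  rewrite /ball/= !ltr_norml => /andP[? ?] /andP[? ?]; apply/andP; split; lra.
have hm t : x <= t <= y -> m <= h (c t).1 (c t).2.
  by move=> txy; case/andP: (mh _ _ (ct _ (sub01 _ _ _ x0 y1 txy)) (inball _ txy)).
rewrite /Q.
have x01 : 0 <= x <= 1 by rewrite x0 (le_trans xy).
have y01 : 0 <= y <= 1 by rewrite y1 (le_trans x0).
rewrite (surjective_pairing (c x)) (surjective_pairing (c y)).
apply: le_trans (fL _ _ _ _ (ct _ x01) (ct _ y01)) _.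
rewrite /k -mulrA ler_wpM2l// mulrDl mul1r.
have iS := ispeed _ _ x0 y1.
have mI : measurable (`[x, y]%classic : set (measurableTypeR R)) by [].
apply: lerD.
  rewrite distrC; apply: le_trans (C1_increment_le du cdu xy) _.
  rewrite -RintegralZl//; apply: le_Rintegral => //.
  - apply: continuous_on_segment_integrable => t _; apply: cvg_norm; exact: cdu.
  - by have := integrableZl mI m^-1 iS; apply: eq_integrable => // t _; rewrite /= EFinM.
  move=> t; rewrite /= in_itv/= => txy.
  have cSt : strip_dom l a b (c t) by apply: cS; exact: (sub01 x y).
  rewrite ler_pdivlMl// (speedE hh cSt).
  have hmt := hm _ txy; set u' := derive1 _ t.
  apply: (@le_trans _ _ `|h (c t).1 (c t).2 * u'|).
    rewrite normrM ler_wpM2r// (le_trans hmt)// ler_norm //.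
  by rewrite -sqrtr_sqr ler_sqrt ?addr_ge0 ?sqr_ge0// lerDl sqr_ge0.
rewrite distrC; apply: le_trans (C1_increment_le dv cdv xy) _.
apply: le_Rintegral => //.
  by apply: continuous_on_segment_integrable => t _; apply: cvg_norm; exact: cdv.
move=> t; rewrite /= in_itv/= => txy.
have cSt : strip_dom l a b (c t) by apply: cS; exact: (sub01 x y).
rewrite (speedE hh cSt) -sqrtr_sqr.
by rewrite ler_sqrt ?addr_ge0 ?sqr_ge0// lerDr sqr_ge0.
Qed.

End path_lipschitz.

(** * The extremal profile *)

Definition clamp (R : realType) (x y s : R) : R := Num.max x (Num.min y s).

Section clamp.
Variable R : realType.
Implicit Types x y s : R.

Lemma clamp_in x y s : x <= y -> x <= clamp x y s <= y.
Proof.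
move=> xy; rewrite /clamp le_max lexx /= ge_max xy /=.
by rewrite ge_min lexx.
Qed.

Lemma clamp_id x y s : x <= s <= y -> clamp x y s = s.
Proof. by move=> /andP[xs sy]; rewrite /clamp min_r// max_r. Qed.

Lemma clamp_low x y s : x <= y -> s <= x -> clamp x y s = x.
Proof.
by move=> xy sx; rewrite /clamp min_r ?(le_trans sx)// max_l.
Qed.

Lemma clamp_high x y s : x <= y -> y <= s -> clamp x y s = y.
Proof. by move=> xy ys; rewrite /clamp min_l// max_r. Qed.

Lemma min_dist x s x' s' : `|Num.min x s - Num.min x' s'| <= `|x - x'| + `|s - s'|.
Proof.
have h1 := ler_norm (x - x'); have h2 := ler_norm (x' - x).
have h3 := ler_norm (s - s'); have h4 := ler_norm (s' - s).
rewrite distrC in h2; rewrite distrC in h4.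
by have [?|?] := leP x s; have [?|?] := leP x' s';
  rewrite ler_norml; apply/andP; split; lra.
Qed.

Lemma max_dist x s x' s' : `|Num.max x s - Num.max x' s'| <= `|x - x'| + `|s - s'|.
Proof.
have h1 := ler_norm (x - x'); have h2 := ler_norm (x' - x).
have h3 := ler_norm (s - s'); have h4 := ler_norm (s' - s).
rewrite distrC in h2; rewrite distrC in h4.
by have [?|?] := leP x s; have [?|?] := leP x' s';
  rewrite ler_norml; apply/andP; split; lra.
Qed.

Lemma clamp_dist x y s x' y' s' :
  `|clamp x y s - clamp x' y' s'| <= `|x - x'| + `|y - y'| + `|s - s'|.
Proof.
rewrite -addrA; apply: le_trans (max_dist _ _ _ _) _.
by rewrite lerD2l; exact: min_dist.
Qed.

End clamp.

Section boundary.
Variables (R : realType) (l a b : R) (a1 a2 : R -> R).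
Hypotheses (hl : 0 < l).
Hypotheses (pw1 : piecewise_differentiable l a1) (pw2 : piecewise_differentiable l a2).
Hypothesis btw : forall t, 0 <= t <= l -> [/\ a < a1 t, a1 t < a2 t & a2 t < b].

Lemma clamp_param_in t : 0 <= clamp 0 l t <= l.
Proof. by apply: clamp_in; exact: ltW. Qed.

Lemma clamped_boundary_lipschitz : exists2 k, 0 <= k & forall t t',
  `|a1 (clamp 0 l t) - a1 (clamp 0 l t')| <= k * `|t - t'| /\
  `|a2 (clamp 0 l t) - a2 (clamp 0 l t')| <= k * `|t - t'|.
Proof.
have [[k1 lip1] _] := pw1; have [[k2 lip2] _] := pw2.
exists (`|k1| + `|k2|) => [|t t']; first exact: addr_ge0.
have cd : `|clamp 0 l t - clamp 0 l t'| <= `|t - t'|.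
  by have := clamp_dist 0 l t 0 l t'; rewrite !subrr !normr0 !add0r.
split; (apply: le_trans; [apply: lip1 || apply: lip2; exact: clamp_param_in|]).
  apply: le_trans (ler_wpM2r (normr_ge0 _) (ler_norm k1)) _.
  by rewrite mulrDl ler_wpDr ?mulr_ge0// ler_wpM2l.
apply: le_trans (ler_wpM2r (normr_ge0 _) (ler_norm k2)) _.
by rewrite mulrDl ler_wpDl ?mulr_ge0// ler_wpM2l.
Qed.

Lemma clamped_boundary_continuous :
  continuous (fun t => a1 (clamp 0 l t)) /\ continuous (fun t => a2 (clamp 0 l t)).
Proof.
have [k _ lip] := clamped_boundary_lipschitz.
by split; apply: (@lipschitz_continuous _ _ k) => t t'; have [] := lip t t'.
Qed.

Lemma boundary_bounds : exists c0 d0 gap, [/\ a < c0, d0 < b, 0 < gap &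
  forall t, 0 <= t <= l -> [/\ c0 <= a1 t, a1 t + gap <= a2 t & a2 t <= d0]].
Proof.
have [c1 c2] := clamped_boundary_continuous.
have wc (f : R -> R) : continuous f -> {within `[0, l], continuous f}.
  by move=> cf; exact: continuous_subspaceT.
have [t1 t1I m1] := EVT_min (ltW hl) (wc _ c1).
have [t2 t2I m2] := EVT_max (ltW hl) (wc _ c2).
have c3 : continuous (fun t => a2 (clamp 0 l t) - a1 (clamp 0 l t)).
  by move=> t; apply: cvgB; [exact: c2|exact: c1].
have [t3 t3I m3] := EVT_min (ltW hl) (wc _ c3).
have [? _ _] := btw (clamp_param_in t1); have [_ _ ?] := btw (clamp_param_in t2).
have [_ ? _] := btw (clamp_param_in t3).
exists (a1 (clamp 0 l t1)), (a2 (clamp 0 l t2)),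
  (a2 (clamp 0 l t3) - a1 (clamp 0 l t3)); split => //; first by rewrite subr_gt0.
move=> t tI; have tI' : t \in `[0, l] by rewrite in_itv.
split.
- by have := m1 _ tI'; rewrite (clamp_id tI).
- by have := m3 _ tI'; rewrite (clamp_id tI) lerBrDl.
- by have := m2 _ tI'; rewrite (clamp_id tI).
Qed.

End boundary.

Section profile.
Variables (R : realType) (S : surface R) (l a b eps : R) (psi : R * R -> S)
  (h H : R -> R -> R) (a1 a2 : R -> R).
Let W : set (R * R) := `]- eps, l + eps[ `*` `]a, - a[.
Hypotheses (hl : 0 < l) (eps0 : 0 < eps) (ba : b <= - a).
Hypotheses (ch : chart W psi) (hh : fermi_metric l a b psi h).
Hypothesis hH : forall t s, strip_dom l a b (t, s) -> is_derive s 1 (H t) (h t s)^-1.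
Hypotheses (pw1 : piecewise_differentiable l a1) (pw2 : piecewise_differentiable l a2).
Hypothesis btw : forall t, 0 <= t <= l -> [/\ a < a1 t, a1 t < a2 t & a2 t < b].

Lemma inv_metric_lipschitz c0 d0 : a < c0 -> d0 < b ->
  exists2 k, 0 <= k & forall t t' s, 0 <= t <= l -> 0 <= t' <= l -> c0 <= s <= d0 ->
    `|(h t s)^-1 - (h t' s)^-1| <= k * `|t - t'|.
Proof.
move=> ac db.
have [m [B' [m0 _ mh]]] := metric_bounds eps0 ba ch hh ac db.
have [sE _ _] := metric_smooth ch.
have [_ cd1 dE _ _] := smooth_on_C1 sE.
have sdom t s : 0 <= t <= l -> c0 <= s <= d0 -> strip_dom l a b (t, s).
  move=> tI /andP[cs sd]; apply/strip_domP; split => //.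
  by rewrite (lt_le_trans ac)//= (le_lt_trans sd).
have sW t s : 0 <= t <= l -> c0 <= s <= d0 -> W (t, s).
  by move=> tI sI; apply: (strip_dom_chart eps0 ba); exact: sdom.
have [B B0 BE] := rectangle_bounded cd1 sW.
exists (B / (2 * m ^+ 3)) => [|t t' s tI tI' sI].
  by rewrite divr_ge0 ?mulr_ge0 ?exprn_ge0 ?ltW.
have [h0 hE _ _] := hh (sdom _ _ tI sI); have [h0' hE' _ _] := hh (sdom _ _ tI' sI).
have /andP[mh1 _] := mh _ _ tI sI; have /andP[mh2 _] := mh _ _ tI' sI.
have : `|gE psi (t, s) - gE psi (t', s)| <= B * `|t - t'|.
  apply: (@lipschitz_of_derive R (fun t => gE psi (t, s)) (fun t => d1 (gE psi) (t, s))
    B 0 l) => // x xI; first by apply: dE; exact: sW.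
  exact: BE.
rewrite hE hE' subr_sqr normrM => hB.
have hp : 0 < h t s * h t' s by rewrite mulr_gt0.
have -> : (h t s)^-1 - (h t' s)^-1 = - ((h t s - h t' s) / (h t s * h t' s)).
  by field; rewrite !gt_eqF.
rewrite normrN normrM normfV (gtr0_norm hp).
have hmm : m ^+ 2 <= h t s * h t' s by rewrite expr2 ler_pM// ltW.
have hd : `|h t s - h t' s| <= B * `|t - t'| / (2 * m).
  rewrite ler_pdivlMr ?mulr_gt0//; apply: le_trans hB; rewrite ler_wpM2l//.
  by rewrite gtr0_norm ?addr_gt0//; lra.
have -> : B / (2 * m ^+ 3) * `|t - t'| = (B * `|t - t'| / (2 * m)) / m ^+ 2.
  by field; rewrite gt_eqF.
apply: ler_pM => //; first by rewrite invr_ge0 ltW.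
by rewrite lef_pV2// posrE// exprn_gt0.
Qed.

(** Each [H t] is only determined up to a constant that may depend on [t] in any
way, so that only the increments of [H t] and [H t'] can be compared. *)
Lemma potential_increment_close c0 d0 t t' e x y : a < c0 -> d0 < b ->
  0 <= t <= l -> 0 <= t' <= l ->
  (forall s, c0 <= s <= d0 -> `|(h t s)^-1 - (h t' s)^-1| <= e) ->
  c0 <= x <= d0 -> c0 <= y <= d0 ->
  `|(H t y - H t x) - (H t' y - H t' x)| <= e * `|y - x|.
Proof.
move=> ac db tI tI' he xI yI.
have -> : (H t y - H t x) - (H t' y - H t' x) = (H t y - H t' y) - (H t x - H t' x) by ring.
apply: (@lipschitz_of_derive R (fun s => H t s - H t' s)
  (fun s => (h t s)^-1 - (h t' s)^-1) e c0 d0) => // s sI.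
have dom t1 : 0 <= t1 <= l -> strip_dom l a b (t1, s).
  have /andP[cs sd] := sI; move=> t1I; apply/strip_domP; split => //.
  by rewrite (lt_le_trans ac)//= (le_lt_trans sd).
by apply: is_deriveB; apply: hH; exact: dom.
Qed.

Lemma potential_increment_le c0 d0 t m x y : a < c0 -> d0 < b -> 0 < m -> 0 <= t <= l ->
  (forall s, c0 <= s <= d0 -> m <= h t s) ->
  c0 <= x <= d0 -> c0 <= y <= d0 -> `|H t y - H t x| <= m^-1 * `|y - x|.
Proof.
move=> ac db m0 tI hm xI yI.
apply: (@lipschitz_of_derive R (H t) (fun s => (h t s)^-1) m^-1 c0 d0) => // s sI.
  apply: hH; case/andP: sI => cs sd; apply/strip_domP; split => //.
  by rewrite (lt_le_trans ac)//= (le_lt_trans sd).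
have h0 : 0 < h t s by apply: lt_le_trans m0 (hm _ sI).
by rewrite gtr0_norm ?invr_gt0// lef_pV2 ?posrE//; exact: hm.
Qed.

Lemma potential_increment_ge t B x y : 0 < B -> 0 <= t <= l -> a < x -> y < b -> x <= y ->
  (forall s, x <= s <= y -> h t s <= B) -> B^-1 * (y - x) <= H t y - H t x.
Proof.
move=> B0 tI ax yb xy hB.
have dom s : x <= s <= y -> strip_dom l a b (t, s).
  case/andP => xs sy; apply/strip_domP; split => //.
  by rewrite (lt_le_trans ax)//= (le_lt_trans sy).
have [s sI|  |s] := @MVT_segment R (H t) (fun s => (h t s)^-1) x y xy.
- by apply/hH/dom; move: sI; rewrite in_itv/= => /andP[/ltW -> /ltW ->].
- apply: derivable_within_continuous => s; rewrite in_itv/= => /dom/hH.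
  by case.
rewrite in_itv/= => sI ->; rewrite ler_wpM2r ?subr_ge0//.
have [h0 _ _ _] := hh (dom _ sI).
by rewrite lef_pV2 ?posrE//; exact: hB.
Qed.

Definition profile_num (u : R * R) : R :=
  let t := clamp 0 l u.1 in H t (clamp (a1 t) (a2 t) u.2) - H t (a1 t).

Definition width (t : R) : R :=
  H (clamp 0 l t) (a2 (clamp 0 l t)) - H (clamp 0 l t) (a1 (clamp 0 l t)).

(** On each line [t = const] this is the solution of the Euler-Lagrange equation
[(h f')' = 0] with boundary values 0 and 1.  Clamping both variables makes it a
Lipschitz function on the whole plane, constant beyond the boundary curves. *)
Definition extremal_profile (u : R * R) : R := profile_num u / width u.1.


Lemma potential_nondecreasing t x y : 0 <= t <= l -> a < x -> y < b -> x <= y -> H t x <= H t y.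
Proof.
move=> tI ax yb xy.
have [m [B [m0 B0 hB]]] := metric_bounds eps0 ba ch hh ax yb.
have := potential_increment_ge B0 tI ax yb xy (fun s sI => proj2 (andP (hB t s tI sI))).
move=> le1; rewrite -subr_ge0; apply: le_trans le1.
by rewrite mulr_ge0 ?subr_ge0// invr_ge0 ltW.
Qed.

Lemma clamp_boundary t s : 0 <= t <= l -> a1 t <= clamp (a1 t) (a2 t) s <= a2 t.
Proof. by move=> /btw[_ lt12 _]; apply: clamp_in; exact: ltW. Qed.

Lemma profile_num_bounds u : 0 <= profile_num u <= width u.1.
Proof.
have tI := clamp_param_in hl u.1; have [at1 t12 t2b] := btw tI.
have /andP[y1 y2] := clamp_boundary u.2 tI.
rewrite /profile_num /width subr_ge0; apply/andP; split.
  by apply: potential_nondecreasing => //; exact: le_lt_trans t2b.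
by rewrite lerD2r; apply: potential_nondecreasing => //; exact: lt_le_trans y1.
Qed.

Lemma width_lower_bound : exists2 delta, 0 < delta & forall t, delta <= width t.
Proof.
have [c0 [d0 [gap [ac db gap0 bds]]]] := boundary_bounds hl pw1 pw2 btw.
have [m [B [m0 B0 hB]]] := metric_bounds eps0 ba ch hh ac db.
exists (B^-1 * gap) => [|t]; first by rewrite mulr_gt0 ?invr_gt0.
have tI := clamp_param_in hl t; have [at1 t12 t2b] := btw tI; have [b1 b2 b3] := bds _ tI.
have := @potential_increment_ge (clamp 0 l t) B _ _ B0 tI at1 t2b (ltW t12).
rewrite /width => Hge; apply: le_trans (Hge _) => [|s /andP[s1 s2]].
  by rewrite ler_wpM2l ?invr_ge0 ?lerBrDl// ltW.
have sI : c0 <= s <= d0 by rewrite (le_trans b1)//= (le_trans s2).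
by have /andP[] := hB _ _ tI sI.
Qed.

Lemma width_gt0 t : 0 < width t.
Proof. by have [delta d0] := width_lower_bound; move=> /(_ t); exact: lt_le_trans. Qed.

Lemma profile_num_lipschitz : exists2 C, 0 <= C &
  forall u v, `|profile_num u - profile_num v| <= C * (`|u.1 - v.1| + `|u.2 - v.2|).
Proof.
have [c0 [d0 [gap [ac db gap0 bds]]]] := boundary_bounds hl pw1 pw2 btw.
have [m [B [m0 B0 hB]]] := metric_bounds eps0 ba ch hh ac db.
have [k k0 lip] := clamped_boundary_lipschitz hl pw1 pw2.
have [L L0 hL] := inv_metric_lipschitz ac db.
have cd : 0 <= d0 - c0.
  have I0 : (0 : R) <= 0 <= l by rewrite lexx ltW.
  by have [b1 b2 b3] := bds _ I0; lra.
have mi : 0 <= m^-1 by rewrite invr_ge0 ltW.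
exists (L * (d0 - c0) + (k + k + k + 1) * m^-1) => [|[t s] [t' s']].
  by apply: addr_ge0; apply: mulr_ge0 => //; rewrite !addr_ge0.
rewrite /profile_num /=; set tau := clamp 0 l t; set tau' := clamp 0 l t'.
have tI : 0 <= tau <= l := clamp_param_in hl t; have tI' : 0 <= tau' <= l := clamp_param_in hl t'.
have [x1 gapx x2] := bds _ tI; have [x1' gapx' x2'] := bds _ tI'.
have /andP[y1 y2] := clamp_boundary s tI; have /andP[y1' y2'] := clamp_boundary s' tI'.
have [l1 l2] := lip t t'; rewrite -/tau -/tau' in l1 l2.
have ly := clamp_dist (a1 tau) (a2 tau) s (a1 tau') (a2 tau') s'.
have lt : `|tau - tau'| <= `|t - t'|.
  by have := clamp_dist 0 l t 0 l t'; rewrite !subrr !normr0 !add0r.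
move: y1 y2 y1' y2' l1 l2 ly; set y := clamp _ _ s; set y' := clamp _ _ s'.
set x := a1 tau in x1 gapx *; set x' := a1 tau' in x1' gapx' *.
move=> y1 y2 y1' y2' l1 l2 ly.
have xI : c0 <= x <= d0 by apply/andP; split; lra.
have xI' : c0 <= x' <= d0 by apply/andP; split; lra.
have yI : c0 <= y <= d0 by apply/andP; split; lra.
have yI' : c0 <= y' <= d0 by apply/andP; split; lra.
have hm t1 : 0 <= t1 <= l -> forall r, c0 <= r <= d0 -> m <= h t1 r.
  by move=> t1I r rI; have /andP[] := hB _ _ t1I rI.
have e1 := potential_increment_close ac db tI tI' (fun r => hL tau tau' r tI tI') xI yI.
have e2 := potential_increment_le ac db m0 tI' (hm _ tI') yI' yI.
have e3 := potential_increment_le ac db m0 tI' (hm _ tI') xI' xI.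
have -> : H tau y - H tau x - (H tau' y' - H tau' x') =
  ((H tau y - H tau x) - (H tau' y - H tau' x)) +
  ((H tau' y - H tau' y') - (H tau' x - H tau' x')) by ring.
apply: le_trans (ler_normD _ _) _.
apply: le_trans (lerD (lexx _) (ler_normB _ _)) _.
set T := `|t - t'| in l1 l2 lt *; set Sd := `|s - s'| in ly *.
have T0 : 0 <= T by exact: normr_ge0.
have S0 : 0 <= Sd by exact: normr_ge0.
have e1' : L * `|tau - tau'| * `|y - x| <= L * (d0 - c0) * T.
  rewrite -!mulrA ler_wpM2l// (mulrC (d0 - c0)) ler_pM//.
  by rewrite ler_norml; apply/andP; split; lra.
have e2' : m^-1 * `|y - y'| <= m^-1 * (k * T + k * T + Sd).
  by rewrite ler_wpM2l// (le_trans ly)// lerD2r lerD.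
have e3' : m^-1 * `|x - x'| <= m^-1 * (k * T) by rewrite ler_wpM2l.
have kS : 0 <= m^-1 * ((k + k + k) * Sd) by rewrite !mulr_ge0 ?addr_ge0.
have LS : 0 <= L * (d0 - c0) * Sd by rewrite !mulr_ge0.
have mT : 0 <= m^-1 * T by rewrite mulr_ge0.
apply: le_trans (lerD e1 (lerD e2 e3)) _.
apply: le_trans (lerD e1' (lerD e2' e3')) _.
have -> : (L * (d0 - c0) + (k + k + k + 1) * m^-1) * (T + Sd) =
  L * (d0 - c0) * T + L * (d0 - c0) * Sd + m^-1 * (k * T + k * T + Sd) + m^-1 * (k * T)
  + m^-1 * ((k + k + k) * Sd) + m^-1 * T by ring.
lra.
Qed.

(** Clamping makes [width] a restriction of [profile_num], so that its Lipschitz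
estimate comes for free. *)
Lemma width_profile_num : exists d0, d0 < b /\ forall t, width t = profile_num (t, d0).
Proof.
have [c0 [d0 [gap [ac db gap0 bds]]]] := boundary_bounds hl pw1 pw2 btw.
exists d0; split => // t; rewrite /profile_num /=.
have tI := clamp_param_in hl t; have [_ t12 _] := btw tI; have [_ _ b3] := bds _ tI.
by rewrite /width (clamp_high (ltW t12) b3).
Qed.

(** A quotient of Lipschitz functions whose denominator is bounded below and
whose numerator is between 0 and the denominator. *)
Lemma extremal_profile_lipschitz : exists2 C, 0 <= C &
  forall u v, `|extremal_profile u - extremal_profile v| <= C * (`|u.1 - v.1| + `|u.2 - v.2|).
Proof.
have [C C0 lip] := profile_num_lipschitz.
have [d0 [_ wE]] := width_profile_num.
have [delta delta0 wd] := width_lower_bound.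
exists (2 * C / delta) => [|u v]; first by rewrite !mulr_ge0 ?invr_ge0// ltW.
rewrite /extremal_profile; set T := `|u.1 - v.1|; set Sd := `|u.2 - v.2|.
have T0 : 0 <= T by exact: normr_ge0.
have S0 : 0 <= Sd by exact: normr_ge0.
have lipN := lip u v.
have lipw : `|width u.1 - width v.1| <= C * T.
  by rewrite !wE; have := lip (u.1, d0) (v.1, d0); rewrite /= subrr normr0 addr0.
have /andP[Nv0 Nvw] := profile_num_bounds v.
have wu := wd u.1; have wv := wd v.1.
have wu0 := width_gt0 u.1; have wv0 := width_gt0 v.1.
move: lipN lipw Nv0 Nvw wu wv wu0 wv0.
set Nu := profile_num u; set Nv := profile_num v; set wu := width u.1; set wv := width v.1.
move=> lipN lipw Nv0 Nvw dwu dwv wu0 wv0.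
have -> : Nu / wu - Nv / wv = ((Nu - Nv) - (Nv / wv) * (wu - wv)) / wu.
  by field; rewrite !gt_eqF.
rewrite normrM normfV (gtr0_norm wu0).
have q1 : `|Nv / wv| <= 1.
  rewrite ger0_norm; last by rewrite divr_ge0// ltW.
  by rewrite ler_pdivrMr// mul1r.
have num : `|(Nu - Nv) - (Nv / wv) * (wu - wv)| <= 2 * C * (T + Sd).
  apply: le_trans (ler_normB _ _) _; rewrite normrM.
  have : `|Nv / wv| * `|wu - wv| <= 1 * (C * T) by rewrite ler_pM.
  have CS : 0 <= C * Sd by rewrite mulr_ge0.
  move=> h1; apply: le_trans (lerD lipN h1) _.
  have -> : 2 * C * (T + Sd) = C * (T + Sd) + 1 * (C * T) + C * Sd by ring.
  by rewrite lerDl.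
rewrite (mulrAC (2 * C)); apply: ler_pM => //; first by rewrite invr_ge0 ltW.
by rewrite lef_pV2 ?posrE.
Qed.

Lemma extremal_profile_low t s : 0 <= t <= l -> s <= a1 t -> extremal_profile (t, s) = 0.
Proof.
move=> tI sa; have [_ t12 _] := btw tI.
by rewrite /extremal_profile /profile_num /= clamp_id// clamp_low ?(ltW t12)// subrr mul0r.
Qed.

Lemma extremal_profile_high t s : 0 <= t <= l -> a2 t <= s -> extremal_profile (t, s) = 1.
Proof.
move=> tI sa; have [_ t12 _] := btw tI; have := width_gt0 t.
rewrite /extremal_profile /profile_num /width /= (clamp_id tI) clamp_high ?(ltW t12)//.
by move=> w0; rewrite divff// gt_eqF.
Qed.

Lemma extremal_profile_mid t s : 0 <= t <= l -> a1 t <= s <= a2 t ->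
  extremal_profile (t, s) = (H t s - H t (a1 t)) / (H t (a2 t) - H t (a1 t)).
Proof.
move=> tI sI; rewrite /extremal_profile /profile_num /width /= (clamp_id tI).
by rewrite clamp_id.
Qed.

Lemma extremal_profile_periodic : a1 0 = a1 l -> a2 0 = a2 l ->
  (forall s, a < s < b -> h 0 s = h l s) ->
  forall s, extremal_profile (0, s) = extremal_profile (l, s).
Proof.
move=> p1 p2 hper s.
have I0 : (0 : R) <= 0 <= l by rewrite lexx ltW.
have Il : (0 : R) <= l <= l by rewrite lexx ltW.
have [c0 [d0 [gap [ac db gap0 bds]]]] := boundary_bounds hl pw1 pw2 btw.
have eH x y : c0 <= x <= d0 -> c0 <= y <= d0 -> H 0 y - H 0 x = H l y - H l x.
  move=> xI yI; apply/eqP; rewrite -subr_eq0 -normr_le0.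
  rewrite -[leRHS](mul0r `|y - x|); apply: (@potential_increment_close c0 d0) => //.
  move=> r /andP[cr rd]; rewrite hper ?subrr ?normr0//.
  by rewrite (lt_le_trans ac)//= (le_lt_trans rd).
rewrite /extremal_profile /profile_num /width /= (clamp_id I0) (clamp_id Il) -p1 -p2.
have [b1 b2 b3] := bds _ I0; have [_ t12 _] := btw I0.
have /andP[y1 y2] := clamp_boundary s I0.
by rewrite eH ?(eH (a1 0) (a2 0))//; apply/andP; split; lra.
Qed.

Lemma extremal_profile_d2 t s : 0 <= t <= l -> a1 t < s < a2 t ->
  is_derive s 1 (fun s => extremal_profile (t, s))
    ((h t s)^-1 / (H t (a2 t) - H t (a1 t))).
Proof.
move=> tI /andP[s1 s2]; have [at1 t12 t2b] := btw tI.
pose D := H t (a2 t) - H t (a1 t).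
have dom : strip_dom l a b (t, s).
  by apply/strip_domP; split => //; rewrite (lt_trans at1)//= (lt_trans s2).
apply: (@near_eq_is_derive _ _ _ (fun s => D^-1 * (H t s - H t (a1 t)))).
  have n1 : \forall r \near s, a1 t < r by exact: lt_nbhsr.
  have n2 : \forall r \near s, r < a2 t by exact: lt_nbhsl.
  apply: filterS2 n1 n2 => r r1 r2.
  by rewrite extremal_profile_mid// ?(ltW r1) ?(ltW r2)// mulrC.
have dH := hH dom.
by apply: is_derive_eq; rewrite /GRing.scale/=; ring.
Qed.

End profile.

(** * Iterated integrals between two graphs *)

Lemma fubini_F_patch (R : realType) (D : set (R * R)) (f : R * R -> \bar R) :
  fubini_F (@lebesgue_measure R) (f \_ D) =
  (fun t => \int[lebesgue_measure]_(s in [set s | D (t, s)]) f (t, s))%E.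
Proof.
apply/funext => t; rewrite /fubini_F [RHS]integral_mkcond.
apply: eq_integral => s _; rewrite /patch.
by congr (if _ then _ else _); apply/idP/idP => /set_mem Ds; exact: mem_set.
Qed.

Lemma integral_sections (R : realType) (D : set (R * R)) (f : R * R -> \bar R) :
  measurable D -> measurable_fun D f -> (forall u, D u -> (0 <= f u)%E) ->
  (\int[@lebesgue_measure R \x @lebesgue_measure R]_(u in D) f u =
   \int[lebesgue_measure]_t \int[lebesgue_measure]_(s in [set s | D (t, s)]) f (t, s))%E.
Proof.
move=> mD mf f0; rewrite integral_mkcond fubini_tonelli1; last 2 first.
- exact/(measurable_restrictT _ mD).
- by move=> u; rewrite /patch; case: ifPn => // /set_mem; exact: f0.
by apply: eq_integral => t _; exact: (congr1 (@^~ t) (fubini_F_patch D f)).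
Qed.

Lemma measurable_fun_section_integral (R : realType) (D : set (R * R))
    (f : R * R -> \bar R) :
  measurable D -> measurable_fun D f -> (forall u, D u -> (0 <= f u)%E) ->
  measurable_fun setT
    (fun t => \int[lebesgue_measure]_(s in [set s | D (t, s)]) f (t, s))%E.
Proof.
move=> mD mf f0; rewrite -(fubini_F_patch D f).
apply: measurable_fun_fubini_tonelli_F; first exact/(measurable_restrictT _ mD).
by move=> u; rewrite /patch; case: ifPn => // /set_mem; exact: f0.
Qed.

(** The boolean says whether the boundary curves belong to the region.  Both
versions are needed: energies are integrals over the closed region, whereas
derivatives are only controlled in the interior. *)
Definition between (R : realType) (l : R) (a1 a2 : R -> R) (c : bool) : set (R * R) :=
  [set u | 0 <= u.1 <= l /\
    u.2 \in Interval (BSide c (a1 u.1)) (BSide (~~ c) (a2 u.1))].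

Section between.
Variables (R : realType) (l : R) (a1 a2 : R -> R).
Hypotheses (hl : 0 < l).
Hypotheses (pw1 : piecewise_differentiable l a1) (pw2 : piecewise_differentiable l a2).

Lemma between_measurable c : measurable (between l a1 a2 c).
Proof.
have [c1 c2] := clamped_boundary_continuous hl pw1 pw2.
pose g1 (u : R * R) := u.2 - a1 (clamp 0 l u.1).
pose g2 (u : R * R) := a2 (clamp 0 l u.1) - u.2.
have cfst : continuous (fst : R * R -> R) by move=> [x y]; exact: cvg_fst.
have csnd : continuous (snd : R * R -> R) by move=> [x y]; exact: cvg_snd.
have mcont (g : R * R -> R) : continuous g -> measurable_fun setT g.
  move=> cg; apply: continuous_prod_measurable_fun; first exact: openT.
  by move=> u _; exact: cg.
have mg1 : measurable_fun setT g1.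
  apply: mcont => u; apply: cvgB; first exact: csnd.
  exact: (@continuous_comp _ _ _ fst (fun t => a1 (clamp 0 l t)) u (cfst u) (c1 _)).
have mg2 : measurable_fun setT g2.
  apply: mcont => u; apply: cvgB; last exact: csnd.
  exact: (@continuous_comp _ _ _ fst (fun t => a2 (clamp 0 l t)) u (cfst u) (c2 _)).
have -> : between l a1 a2 c = (fst @^-1` `[0, l]) `&`
    ((g1 @^-1` [set` Interval (BSide c 0) +oo%O]) `&`
     (g2 @^-1` [set` Interval (BSide c 0) +oo%O])).
  apply/seteqP; split => [[t s]|[t s]] /=; rewrite /between /g1 /g2 /=.
    move=> [tI]; rewrite (clamp_id tI) !itv_boundlr /= !bnd_simp; case: c => /=;
      rewrite !bnd_simp => /andP[? ?]; split; rewrite ?andbT ?subr_ge0 ?subr_gt0//.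
  move=> [tI]; rewrite in_itv/= in tI; rewrite (clamp_id tI) !itv_boundlr /=.
  case: c => /=; rewrite !bnd_simp ?andbT ?subr_ge0 ?subr_gt0 => -[? ?]; split => //;
    exact/andP.
apply: measurableI.
  by rewrite -[X in measurable X]setTI; apply: measurable_fst.
apply: measurableI; rewrite -[X in measurable X]setTI.
  exact: mg1.
exact: mg2.
Qed.

Lemma between_section c t : 0 <= t <= l ->
  [set s | between l a1 a2 c (t, s)] =
  [set` Interval (BSide c (a1 t)) (BSide (~~ c) (a2 t))].
Proof. by move=> tI; apply/seteqP; split => [s []|s] //. Qed.

Lemma between_tonelli c (f : R * R -> \bar R) :
  measurable_fun (between l a1 a2 c) f ->
  (forall u, between l a1 a2 c u -> (0 <= f u)%E) ->
  (\int[@lebesgue_measure R \x @lebesgue_measure R]_(u in between l a1 a2 c) f u =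
   \int[lebesgue_measure]_(t in `[0%R, l])
     \int[lebesgue_measure]_(s in
       [set` Interval (BSide c (a1 t)) (BSide (~~ c) (a2 t))]) f (t, s))%E.
Proof.
move=> mf f0; rewrite integral_sections//; last exact: between_measurable.
rewrite [RHS]integral_mkcond; apply: eq_integral => t _; rewrite /patch.
case: ifPn => [/set_mem|].
  by rewrite /= in_itv/= => tI; rewrite between_section.
move=> tN; rewrite (_ : [set s | _] = set0) ?integral_set0//.
apply/seteqP; split => // s [tI _]; move/negP: tN; apply.
by apply/mem_set; rewrite /= in_itv.
Qed.

Lemma between_inner_measurable c (f : R * R -> \bar R) :
  measurable_fun (between l a1 a2 c) f ->
  (forall u, between l a1 a2 c u -> (0 <= f u)%E) ->
  measurable_fun `[0, l]
    (fun t => \int[lebesgue_measure]_(s in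
       [set` Interval (BSide c (a1 t)) (BSide (~~ c) (a2 t))]) f (t, s))%E.
Proof.
move=> mf f0.
have := measurable_fun_section_integral (between_measurable c) mf f0.
move=> /(measurable_funTS (D := `[0, l])); apply: eq_measurable_fun => t.
by rewrite inE/= in_itv/= => tI; rewrite between_section.
Qed.

End between.

(** * Energies and capacities *)

Lemma lipschitz_plane_continuous (R : realType) (f : R * R -> R) (C : R) : 0 <= C ->
  (forall u v, `|f u - f v| <= C * (`|u.1 - v.1| + `|u.2 - v.2|)) -> continuous f.
Proof.
move=> C0 fC u; apply/cvgrPdist_le => e e0.
have k0 : 0 < (C + 1) * 2 by rewrite mulr_gt0// ltr_wpDl.
have d0 : 0 < e / ((C + 1) * 2) by rewrite divr_gt0.
exists (ball u.1 (e / ((C + 1) * 2)), ball u.2 (e / ((C + 1) * 2))).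
  by split; exact: nbhsx_ballx.
move=> v [/= v1 v2]; apply: le_trans (fC _ _) _.
apply: (@le_trans _ _ ((C + 1) * (`|u.1 - v.1| + `|u.2 - v.2|))).
  by rewrite ler_wpM2r ?addr_ge0// lerDl.
rewrite -ler_pdivlMl ?ltr_wpDl//.
have -> : (C + 1)^-1 * e = e / ((C + 1) * 2) + e / ((C + 1) * 2).
  by field; rewrite gt_eqF// ltr_wpDl.
by apply: lerD; apply: ltW.
Qed.

Section capacity.
Variables (R : realType) (S : surface R) (l a b eps : R) (psi : R * R -> S)
  (M : S -> S) (h H : R -> R -> R) (a1 a2 : R -> R) (A : set S).
Let W : set (R * R) := `]- eps, l + eps[ `*` `]a, - a[.
Hypotheses (hl : 0 < l) (eps0 : 0 < eps) (ba : b <= - a).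
Hypotheses (ch : chart W psi) (hh : fermi_metric l a b psi h).
Hypothesis glue : forall s, a < s < b -> M (psi (0, s)) = psi (l, s).
Hypothesis hH : forall t s, strip_dom l a b (t, s) -> is_derive s 1 (H t) (h t s)^-1.
Hypothesis hper : forall s, a < s < b -> h 0 s = h l s.
Hypotheses (pw1 : piecewise_differentiable l a1) (pw2 : piecewise_differentiable l a2).
Hypothesis btw : forall t, 0 <= t <= l -> [/\ a < a1 t, a1 t < a2 t & a2 t < b].
Hypotheses (per1 : a1 0 = a1 l) (per2 : a2 0 = a2 l).
Hypothesis AE : A = psi @` [set u | 0 <= u.1 <= l /\ a1 u.1 <= u.2 <= a2 u.1].

Local Notation "'region'" := (between l a1 a2).
Local Notation prof := (extremal_profile l H a1 a2).
Local Notation D := (fun t => H t (a2 t) - H t (a1 t)).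

Lemma open_chart_domain : open W. Proof. exact: open_rectangle. Qed.

Lemma psi_inj u v : W u -> W v -> psi u = psi v -> u = v.
Proof.
move=> Wu Wv; have [_ inj _ _] := chart_param ch.
by apply: inj; rewrite inE.
Qed.

Lemma regionP t s : region true (t, s) <-> 0 <= t <= l /\ a1 t <= s <= a2 t.
Proof. by rewrite /between /= in_itv. Qed.

Lemma open_regionP t s : region false (t, s) <-> 0 <= t <= l /\ a1 t < s < a2 t.
Proof. by rewrite /between /= in_itv. Qed.

Lemma region_strip c : region c `<=` strip_dom l a b.
Proof.
move=> [t s]; case: c => [/regionP|/open_regionP] [tI /andP[s1 s2]];
  have [? ? ?] := btw tI; apply/strip_domP; split => //; apply/andP; split; lra.
Qed.

Lemma open_region_sub : region false `<=` region true.
Proof.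
by move=> [t s] /open_regionP[tI /andP[/ltW s1 /ltW s2]]; apply/regionP; rewrite s1.
Qed.

Lemma region_preimage : strip_dom l a b `&` psi @^-1` A = region true.
Proof.
rewrite AE; apply/seteqP; split => [u [su [[t s] tsP] e]|u ru].
  have rv : region true (t, s) by apply/regionP.
  have <- // : (t, s) = u.
  by apply: psi_inj e; apply: (strip_dom_chart eps0 ba) => //; exact: region_strip rv.
by split; [exact: region_strip ru|exists u => //; case: u ru => t s /regionP].
Qed.

Lemma metric_continuous t s : strip_dom l a b (t, s) -> {for s, continuous (h t)}.
Proof.
move=> dom; have [sE _ _] := metric_smooth ch.
have [cE _ _ dE _] := smooth_on_C1 sE.
have Wts : W (t, s) by exact: (strip_dom_chart eps0 ba).
have c1 : {for s, continuous (fun s => gE psi (t, s))}.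
  apply/differentiable_continuous/derivable1_diffP.
  by have [] := dE _ _ Wts.
have c2 : {for s, continuous (fun s => Num.sqrt (gE psi (t, s)))}.
  by apply: (@continuous_comp _ _ _ _ Num.sqrt _ c1); exact: sqrt_continuous.
have /strip_domP[tI /andP[as_ sb]] := dom.
have heq : \forall r \near s, Num.sqrt (gE psi (t, r)) = h t r.
  have n1 : \forall r \near s, a < r by exact: lt_nbhsr.
  have n2 : \forall r \near s, r < b by exact: lt_nbhsl.
  apply: filterS2 n1 n2 => r r1 r2.
  have /hh[h0 -> _ _] : strip_dom l a b (t, r) by apply/strip_domP; rewrite r1.
  by rewrite sqrtr_sqr gtr0_norm.
suff : h t r @[r --> s] --> h t s by [].
have <- : Num.sqrt (gE psi (t, s)) = h t s by exact: (nbhs_singleton heq).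
by apply: cvg_trans c2; apply: near_eq_cvg.
Qed.

Lemma metric_measurable c :
  measurable_fun (region c) (fun u => h u.1 u.2) /\
  measurable_fun (region c) (fun u => (h u.1 u.2)^-1).
Proof.
have [sE _ _] := metric_smooth ch.
have [cE _ _ _ _] := smooth_on_C1 sE.
have csE u : W u -> {for u, continuous (fun u => Num.sqrt (gE psi u))}.
  move=> /cE cEu.
  by apply: (@continuous_comp _ _ _ (gE psi) Num.sqrt _ cEu); exact: sqrt_continuous.
have cisE u : W u -> {for u, continuous (fun u => (Num.sqrt (gE psi u))^-1)}.
  move=> Wu; apply: cvgV; last exact: csE.
  by rewrite gt_eqF// sqrtr_gt0; have [] := metric_pos ch Wu.
have sub : region c `<=` W.
  by move=> u ru; apply: (strip_dom_chart eps0 ba); exact: region_strip ru.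
have hE u : u \in region c -> Num.sqrt (gE psi u) = h u.1 u.2.
  move=> /set_mem; case: u => t s ru.
  by have [h0 -> _ _] := hh (region_strip ru); rewrite sqrtr_sqr gtr0_norm.
split.
  apply: (eq_measurable_fun (fun u => Num.sqrt (gE psi u))); first exact: hE.
  apply: (measurable_funS (open_prod_measurable open_chart_domain) sub).
  exact: continuous_prod_measurable_fun open_chart_domain csE.
apply: (eq_measurable_fun (fun u => (Num.sqrt (gE psi u))^-1)).
  by move=> u /hE ->.
apply: (measurable_funS (open_prod_measurable open_chart_domain) sub).
exact: continuous_prod_measurable_fun open_chart_domain cisE.
Qed.

(** The substitution [z = H t s]. *)
Lemma integral_potential (Phi phi : R -> R) t x y : 0 <= t <= l -> a < x -> x < y -> y < b ->
  (forall z : R, is_derive z 1 Phi (phi z)) -> continuous phi ->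
  (\int[lebesgue_measure]_(s in `[x, y]) (phi (H t s) * (h t s)^-1)%:E
   = (Phi (H t y) - Phi (H t x))%:E)%E.
Proof.
move=> tI ax xy yb dPhi cphi.
have dom s : x <= s <= y -> strip_dom l a b (t, s).
  by case/andP => xs sy; apply/strip_domP; split => //; apply/andP; split; lra.
have dkH s : x <= s <= y -> is_derive s 1 (Phi \o H t) (phi (H t s) * (h t s)^-1).
  by move=> /dom/hH dH; apply: is_derive1_comp.
have ckH s : x <= s <= y -> {for s, continuous (Phi \o H t)}.
  move=> sI; apply/differentiable_continuous/derivable1_diffP.
  by have [] := dkH s sI.
have cH s : x <= s <= y -> {for s, continuous (H t)}.
  move=> sI; apply/differentiable_continuous/derivable1_diffP.
  by have [] := hH (dom s sI).
rewrite (@continuous_FTC2 R (fun s => phi (H t s) * (h t s)^-1) (Phi \o H t))//.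
- apply: continuous_in_subspaceT => s; rewrite inE/= in_itv/= => sI.
  apply: cvgM.
    exact: (@continuous_comp _ _ _ (H t) phi s (cH s sI) (cphi _)).
  apply: cvgV; last exact: metric_continuous (dom _ sI).
  by have [h0 _ _ _] := hh (dom _ sI); rewrite gt_eqF.
- split.
  + move=> s; rewrite in_itv/= => /andP[/ltW xs /ltW sy].
    have sI : x <= s <= y by rewrite xs.
    by have [] := dkH s sI.
  + have xI : x <= x <= y by rewrite lexx ltW.
    by apply: cvg_within_filter; exact: (ckH _ xI).
  + have yI : x <= y <= y by rewrite lexx ltW.
    by apply: cvg_within_filter; exact: (ckH _ yI).
- move=> s; rewrite in_itv/= => /andP[/ltW xs /ltW sy].
  have sI : x <= s <= y by rewrite xs.
  by rewrite derive1E; have [_ ->] := dkH s sI.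
Qed.

(** Only the values on the chart matter; elsewhere [P] takes the value of the
profile at [(0, 0)]. *)
Lemma extremal_exists : exists2 P : S -> R,
  admissible l a b psi M a1 a2 A P & forall u, W u -> P (psi u) = prof u.
Proof.
pose P p := prof (xget (0, 0) [set u | W u /\ psi u = p]).
have PE u : W u -> P (psi u) = prof u.
  move=> Wu; rewrite /P; case: xgetP => [v _ [Wv vu]|/(_ u)]; last by case.
  by rewrite (psi_inj Wv Wu vu).
exists P => //; split.
- have [c0 [d0 [gap [ac db gap0 bds]]]] := boundary_bounds hl pw1 pw2 btw.
  have [C C0 lipf] := extremal_profile_lipschitz hl eps0 ba ch hh hH pw1 pw2 btw.
  have [k k0 pathk] : exists2 k, 0 <= k &
      forall p q L, cyl_path_length l a b psi M p q L -> `|P p - P q| <= k * L.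
    apply: (@path_lipschitz R S l a b eps psi M h hl eps0 ba ch hh glue P prof c0 d0 C) => //.
    + by move=> u su; apply: PE; exact: (strip_dom_chart eps0 ba).
    + move=> t s tI sc; have [c1 _ _] := bds _ tI.
      exact: (extremal_profile_low H btw tI (le_trans sc c1)).
    + move=> t s tI sc; have [_ _ d1] := bds _ tI.
      apply: (extremal_profile_high hl eps0 ba ch hh hH pw1 pw2 btw) => //.
      exact: le_trans d1 sc.
    + move=> s _.
      exact: (extremal_profile_periodic hl hH pw1 pw2 btw).
  exists k => p q [[u su up] _] [[v sv vq] _].
  have pathne : [set L | cyl_path_length l a b psi M p q L] !=set0.
    by rewrite -up -vq; eexists; exact: cyl_path_segment.
  have [k_0|k1] := eqVneq k 0.
    have [L pL] := pathne; have := pathk _ _ _ pL.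
    by rewrite k_0 !mul0r.
  have kp : 0 < k by rewrite lt_neqAle eq_sym k1.
  rewrite -ler_pdivrMl//; apply: lb_le_inf => // L pL.
  by rewrite ler_pdivrMl//; exact: pathk.
- move=> t tI; rewrite PE; last first.
    apply: (strip_dom_chart eps0 ba); apply: (@region_strip true); apply/regionP.
    by have [_ ? _] := btw tI; split => //; rewrite lexx ltW.
  exact: (extremal_profile_low H btw).
- move=> t tI; rewrite PE; last first.
    apply: (strip_dom_chart eps0 ba); apply: (@region_strip true); apply/regionP.
    by have [_ ? _] := btw tI; split => //; rewrite lexx ltW.
  exact: (extremal_profile_high hl eps0 ba ch hh hH pw1 pw2 btw).
Qed.

Lemma extremal_profile_continuous : continuous prof.
Proof.
have [C C0 lipf] := extremal_profile_lipschitz hl eps0 ba ch hh hH pw1 pw2 btw.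
exact: lipschitz_plane_continuous C0 lipf.
Qed.

Lemma section_width_gt0 t : 0 <= t <= l -> 0 < D t.
Proof.
move=> tI; have := width_gt0 hl eps0 ba ch hh hH pw1 pw2 btw t.
by rewrite /width (clamp_id tI).
Qed.

Lemma metric_gt0 c u : region c u -> 0 < h u.1 u.2.
Proof. by case: u => t s /region_strip/hh[]. Qed.

Lemma section_strip t s : 0 <= t <= l -> a1 t < s < a2 t -> strip_dom l a b (t, s).
Proof. by move=> tI sI; apply: (@region_strip false); apply/open_regionP. Qed.

Lemma section_integrand_measurable (phi : R -> R) t : 0 <= t <= l -> continuous phi ->
  measurable_fun `]a1 t, a2 t[ (fun s => phi (H t s) * (h t s)^-1).
Proof.
move=> tI cphi; apply: open_continuous_measurable_fun; first exact: interval_open.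
move=> s /set_mem; rewrite /= in_itv/= => /(section_strip tI) dom.
have cH : {for s, continuous (H t)}.
  apply/differentiable_continuous/derivable1_diffP.
  by have [] := hH dom.
apply: cvgM; first exact: (@continuous_comp _ _ _ (H t) phi s cH (cphi _)).
apply: cvgV; last exact: metric_continuous.
by have [h0 _ _ _] := hh dom; rewrite gt_eqF.
Qed.

Lemma section_metric_measurable t : 0 <= t <= l ->
  measurable_fun `]a1 t, a2 t[ (h t).
Proof.
move=> tI; apply: open_continuous_measurable_fun; first exact: interval_open.
move=> s /set_mem; rewrite /= in_itv/= => /(section_strip tI).
exact: metric_continuous.
Qed.

Lemma section_integral_potential (Phi phi : R -> R) t c : 0 <= t <= l ->
  (forall z : R, is_derive z 1 Phi (phi z)) -> continuous phi ->
  (\int[lebesgue_measure]_(s in [set` Interval (BSide c (a1 t)) (BSide (~~ c) (a2 t))])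
     (phi (H t s) * (h t s)^-1)%:E = (Phi (H t (a2 t)) - Phi (H t (a1 t)))%:E)%E.
Proof.
move=> tI dPhi cphi; have [at1 t12 t2b] := btw tI.
have mo : measurable_fun `]a1 t, a2 t[ (fun s => (phi (H t s) * (h t s)^-1)%:E).
  by apply/measurable_EFinP; exact: section_integrand_measurable.
rewrite (integral_itv_bndoo _ _ mo) -(integral_itv_bndoo true false mo).
exact: integral_potential.
Qed.

Lemma section_integral_cst_inv t k : 0 <= t <= l ->
  (\int[lebesgue_measure]_(s in `]a1 t, a2 t[) (k * (h t s)^-1)%:E = (k * D t)%:E)%E.
Proof.
move=> tI; rewrite mulrBr.
apply: (@section_integral_potential (fun z => k * z) (cst k) t false) => //.
  by move=> z; apply: is_derive_eq; rewrite /GRing.scale/= mulr1.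
by move=> z; exact: cvg_cst.
Qed.

Lemma extremal_profile_d2E t s : 0 <= t <= l -> a1 t < s < a2 t ->
  d2 prof (t, s) = (h t s)^-1 / D t.
Proof.
move=> tI sI; rewrite /d2 derive1E /=.
by have [_ ->] := extremal_profile_d2 hH btw tI sI.
Qed.

Lemma dir_energy_extremal (P : S -> R) : (forall u, W u -> P (psi u) = prof u) ->
  dir_energy l a b psi h A P =
  (\int[lebesgue_measure]_(t in `[0%R, l]) ((D t)^-1)%:E)%E.
Proof.
move=> PE; rewrite /dir_energy region_preimage.
have PE2 u : region true u -> d2 (P \o psi) u = d2 prof u.
  move=> ru; apply: (eq_on_open_d2 open_chart_domain) => //.
  by apply: (strip_dom_chart eps0 ba); exact: region_strip ru.
under eq_integral => u /set_mem ru do rewrite PE2//.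
rewrite (@between_tonelli R l a1 a2 hl pw1 pw2 true
  (fun u => (h u.1 u.2 * d2 prof u ^+ 2)%:E)); last 2 first.
- apply/measurable_EFinP; apply: measurable_funM; first by have [] := metric_measurable true.
  apply: measurable_funX; apply: measurable_funTS.
  exact: measurable_d2 extremal_profile_continuous.
- by move=> u ru; rewrite lee_fin mulr_ge0 ?sqr_ge0// ltW// (metric_gt0 ru).
apply: eq_integral => t /set_mem; rewrite /= in_itv/= => tI.
have [at1 t12 t2b] := btw tI; have Dt0 := section_width_gt0 tI.
have eqo s : s \in `]a1 t, a2 t[%classic ->
    (h t s * d2 prof (t, s) ^+ 2)%:E = ((D t)^-2 * (h t s)^-1)%:E.
  move=> /set_mem; rewrite /= in_itv/= => sI; rewrite extremal_profile_d2E//.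
  have [h0 _ _ _] := hh (section_strip tI sI).
  by congr (_%:E); field; rewrite !gt_eqF.
rewrite integral_itv_bndoo; last first.
  apply: (eq_measurable_fun (fun s => ((D t)^-2 * (h t s)^-1)%:E)).
    by move=> s sI; rewrite eqo.
  apply/measurable_EFinP; apply: (@section_integrand_measurable (cst _)) => //.
  by move=> z; exact: cvg_cst.
transitivity (\int[lebesgue_measure]_(s in `]a1 t, a2 t[)
    ((D t)^-2 * (h t s)^-1)%:E)%E; first by apply: eq_integral => s; exact: eqo.
rewrite section_integral_cst_inv//.
by congr (_%:E); field; rewrite gt_eqF.
Qed.

(** The Cauchy-Schwarz inequality, in the form
[h * x ^+ 2 + lam ^+ 2 / h >= 2 * lam * x] with [lam = (D t)^-1].  As [1 / h]
integrates to [D t] and the derivative of [g] to at least 1, integration gives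
[energy + lam >= 2 * lam]. *)
Lemma slice_lower_bound t (g : R -> R) k : 0 <= t <= l ->
  (forall x y, `|g x - g y| <= k * `|x - y|) -> g (a1 t) = 0 -> g (a2 t) = 1 ->
  (((D t)^-1)%:E <= \int[lebesgue_measure]_(s in `]a1 t, a2 t[)
     (h t s * derive1 g s ^+ 2)%:E)%E.
Proof.
move=> tI gk g1 g2; have [at1 t12 t2b] := btw tI; have Dt0 := section_width_gt0 tI.
have mg : measurable_fun `]a1 t, a2 t[ (derive1 g).
  by apply: measurable_funTS; apply: measurable_derive1; exact: lipschitz_continuous gk.
have dom s : s \in `]a1 t, a2 t[%classic -> 0 < h t s.
  by move=> /set_mem; rewrite /= in_itv/= => /(section_strip tI)/hh[].
have dom' s : `]a1 t, a2 t[%classic s -> 0 < h t s by move=> sI; apply: dom; exact/mem_set.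
set lam := (D t)^-1; have lam0 : 0 < lam by rewrite invr_gt0.
have le2 : ((2 * lam)%:E <= \int[lebesgue_measure]_(s in `]a1 t, a2 t[)
    ((2 * lam)%:E * `|derive1 g s|%:E))%E.
  rewrite ge0_integralZl//.
  - rewrite -[leLHS]mule1; apply: lee_wpmul2l; first by rewrite lee_fin mulr_ge0// ltW.
    by have := lipschitz_diff_le_integral gk t12; rewrite g1 g2 subr0.
  - by apply/measurable_EFinP; exact: measurableT_comp.
  - by rewrite lee_fin mulr_ge0// ltW.
have leXY : (\int[lebesgue_measure]_(s in `]a1 t, a2 t[) ((2 * lam)%:E * `|derive1 g s|%:E)
    <= \int[lebesgue_measure]_(s in `]a1 t, a2 t[)
         ((h t s * derive1 g s ^+ 2)%:E + (lam ^+ 2 * (h t s)^-1)%:E))%E.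
  apply: ge0_le_integral_lower => s sI.
    by rewrite -EFinM lee_fin mulr_ge0// mulr_ge0// ltW.
  rewrite -EFinM -EFinD lee_fin; have h0 := dom' s sI.
  rewrite -(real_normK (num_real (derive1 g s))); set x := `|_|.
  rewrite -subr_ge0.
  have -> : h t s * x ^+ 2 + lam ^+ 2 * (h t s)^-1 - 2 * lam * x
    = (h t s * x - lam) ^+ 2 / h t s by field; rewrite gt_eqF.
  by rewrite divr_ge0 ?sqr_ge0// ltW.
have := le_trans le2 leXY.
rewrite ge0_integralD//; last 4 first.
- by move=> s sI; rewrite lee_fin mulr_ge0 ?sqr_ge0// ltW// dom'.
- apply/measurable_EFinP; apply: measurable_funM; first exact: section_metric_measurable.
  exact: measurable_funX.
- by move=> s sI; rewrite lee_fin mulr_ge0 ?sqr_ge0// invr_ge0 ltW// dom'.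
- apply/measurable_EFinP; apply: (@section_integrand_measurable (cst _)) => //.
  by move=> z; exact: cvg_cst.
rewrite [X in (_ + X)%E]section_integral_cst_inv//.
have -> : lam ^+ 2 * D t = lam by rewrite /lam; field; rewrite gt_eqF.
rewrite -leeBlDr// -EFinB.
by have -> : 2 * lam - lam = lam by ring.
Qed.

Lemma cyl_dist_ge0 u v : strip_dom l a b u -> strip_dom l a b v ->
  0 <= cyl_dist l a b psi M (psi u) (psi v).
Proof.
move=> su sv; apply: lb_le_inf => [|L]; last exact: cyl_path_length_ge0.
by exists (curve_length psi (segment u v)); exact: cyl_path_segment.
Qed.

Lemma region_closure u : region true u -> cyl_closure l a b psi M A (psi u).
Proof.
move=> ru; have su := region_strip ru; split; first by exists u.
move=> e e0; exists (psi u).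
  by have : (strip_dom l a b `&` psi @^-1` A) u by [rewrite region_preimage]; case.
have h0 : 0 <= h u.1 u.2 by rewrite ltW// (metric_gt0 ru).
have := cyl_dist_segment_le M hh su su h0.
rewrite !subrr normr0 mulr0 addr0 => le0; apply: le_lt_trans (le0 _) e0.
by move=> r _; rewrite /segment !subrr !mulr0 !addr0.
Qed.

(** An admissible function is only controlled on the annulus; its extension by
constants beyond the boundary curves is Lipschitz on the whole plane and agrees
with it near each point between the curves. *)
Definition clamped_pullback (F : S -> R) (u : R * R) : R :=
  let t := clamp 0 l u.1 in F (psi (t, clamp (a1 t) (a2 t) u.2)).

Lemma clamped_pullback_lipschitz F : admissible l a b psi M a1 a2 A F ->
  exists2 C, 0 <= C & forall u v,
    `|clamped_pullback F u - clamped_pullback F v| <= C * (`|u.1 - v.1| + `|u.2 - v.2|).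
Proof.
move=> [[kF FL] _ _].
have [c0 [d0 [gap [ac db gap0 bds]]]] := boundary_bounds hl pw1 pw2 btw.
have [m [B [m0 B0 hB]]] := metric_bounds eps0 ba ch hh ac db.
have [k k0 lip] := clamped_boundary_lipschitz hl pw1 pw2.
exists (`|kF| * (B + k + k + 1)) => [|[t s] [t' s']].
  by rewrite mulr_ge0// !addr_ge0// ltW.
rewrite /clamped_pullback /=; set tau := clamp 0 l t; set tau' := clamp 0 l t'.
have tI : 0 <= tau <= l := clamp_param_in hl t; have tI' : 0 <= tau' <= l := clamp_param_in hl t'.
have [x1 gapx x2] := bds _ tI; have [x1' gapx' x2'] := bds _ tI'.
have yI := clamp_boundary btw s tI; have yI' := clamp_boundary btw s' tI'.
have [l1 l2] := lip t t'; rewrite -/tau -/tau' in l1 l2.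
have ly := clamp_dist (a1 tau) (a2 tau) s (a1 tau') (a2 tau') s'.
have lt : `|tau - tau'| <= `|t - t'|.
  by have := clamp_dist 0 l t 0 l t'; rewrite !subrr !normr0 !add0r.
move: yI yI' ly; set y := clamp _ _ s; set y' := clamp _ _ s' => yI yI' ly.
have ru : region true (tau, y) by apply/regionP.
have rv : region true (tau', y') by apply/regionP.
apply: le_trans (FL _ _ (region_closure ru) (region_closure rv)) _.
have su := region_strip ru; have sv := region_strip rv.
apply: le_trans (ler_wpM2r (cyl_dist_ge0 su sv) (ler_norm kF)) _.
rewrite -mulrA ler_wpM2l//.
apply: le_trans (cyl_dist_segment_le M hh su sv (ltW B0) _) _.
  move=> r r01.
  have zI : c0 <= y + r * (y' - y) <= d0.
    move: yI yI' => /andP[? ?] /andP[? ?].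
    by apply: segment_between => //; apply/andP; split; lra.
  by have /andP[] := hB _ _ (segment_between tI tI' r01) zI.
rewrite /= (distrC tau') (distrC y'); set T := `|t - t'| in l1 l2 lt *.
set Sd := `|s - s'| in ly *.
have S0 : 0 <= Sd by exact: normr_ge0.
have e1 : B * `|tau - tau'| <= B * T by rewrite ler_wpM2l// ltW.
have e2 : 0 <= (B + k + k) * Sd by rewrite mulr_ge0// !addr_ge0// ltW.
have T0 : 0 <= T by exact: normr_ge0.
have -> : (B + k + k + 1) * (T + Sd)
  = B * T + (k * T + k * T + Sd) + (B + k + k) * Sd + T by ring.
lra.
Qed.

Lemma clamped_pullback_d2 F u : region false u ->
  d2 (F \o psi) u = d2 (clamped_pullback F) u.
Proof.
case: u => t s /open_regionP[tI /andP[s1 s2]]; rewrite /d2 !derive1E.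
apply: near_eq_derive => /=.
have n1 : \forall r \near s, a1 t < r by exact: lt_nbhsr.
have n2 : \forall r \near s, r < a2 t by exact: lt_nbhsl.
apply: filterS2 n1 n2 => r r1 r2.
by rewrite /clamped_pullback /= (clamp_id tI) clamp_id// (ltW r1) ltW.
Qed.

(** The boundary curves are dropped, as the pullback of [F] has no controlled
derivatives there.  Between them it can be replaced by its clamped extension,
whose derivatives are measurable; then the bound holds on each line
[t = const]. *)
Lemma dir_energy_lower_bound F : admissible l a b psi M a1 a2 A F ->
  (\int[lebesgue_measure]_(t in `[0%R, l]) ((D t)^-1)%:E
   <= dir_energy l a b psi h A F)%E.
Proof.
move=> admF; have [C C0 lipF] := clamped_pullback_lipschitz admF.
have [_ F1 F2] := admF.
rewrite /dir_energy region_preimage.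
have ge0 u : region true u -> (0 <= (h u.1 u.2 * d2 (F \o psi) u ^+ 2)%:E)%E.
  by move=> ru; rewrite lee_fin mulr_ge0 ?sqr_ge0// ltW// (metric_gt0 ru).
have := @ge0_subset_integral_lower _ _ R (@lebesgue_measure R \x @lebesgue_measure R)%E
  _ _ _ open_region_sub ge0.
apply: le_trans.
under eq_integral => u /set_mem ru do rewrite clamped_pullback_d2//.
rewrite (@between_tonelli R l a1 a2 hl pw1 pw2 false
  (fun u => (h u.1 u.2 * d2 (clamped_pullback F) u ^+ 2)%:E)); last 2 first.
- apply/measurable_EFinP; apply: measurable_funM; first by have [] := metric_measurable false.
  apply: measurable_funX; apply: measurable_funTS.
  by apply: measurable_d2; exact: lipschitz_plane_continuous C0 lipF.
- by move=> u ru; rewrite lee_fin mulr_ge0 ?sqr_ge0// ltW// (metric_gt0 ru).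
apply: ge0_le_integral_lower => t; rewrite /= in_itv/= => tI.
  by rewrite lee_fin invr_ge0 ltW// section_width_gt0.
have [at1 t12 t2b] := btw tI.
apply: (@slice_lower_bound t (fun s => clamped_pullback F (t, s)) C) => //.
- by move=> x y; have := lipF (t, x) (t, y); rewrite /= subrr normr0 add0r.
- by rewrite /clamped_pullback /= (clamp_id tI) (clamp_low (ltW t12) (lexx _)) F1.
- by rewrite /clamped_pullback /= (clamp_id tI) (clamp_high (ltW t12) (lexx _)) F2.
Qed.

Lemma dir_energy_le_energy F :
  (dir_energy l a b psi h A F <= energy l a b psi h A F)%E.
Proof.
rewrite /dir_energy /energy region_preimage; apply: ge0_le_integral_lower => u ru.
  by rewrite lee_fin mulr_ge0 ?sqr_ge0// ltW// (metric_gt0 ru).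
by rewrite lee_fin lerDr mulr_ge0 ?sqr_ge0// invr_ge0 ltW// (metric_gt0 ru).
Qed.

Lemma dir_capE : dir_cap l a b psi M h a1 a2 A =
  (\int[lebesgue_measure]_(t in `[0%R, l]) ((D t)^-1)%:E)%E.
Proof.
have [P admP PE] := extremal_exists.
apply/eqP; rewrite eq_le; apply/andP; split.
  rewrite -(dir_energy_extremal PE); apply: ereal_inf_lbound; by exists P.
by apply: le_ereal_inf_tmp => _ [F admF <-]; exact: dir_energy_lower_bound.
Qed.

Lemma dir_cap_le_cap :
  (dir_cap l a b psi M h a1 a2 A <= cap l a b psi M h a1 a2 A)%E.
Proof.
apply: le_ereal_inf_tmp => _ [F admF <-]; apply: le_trans (dir_energy_le_energy F).
by apply: ereal_inf_lbound; exists F.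
Qed.

Lemma cap_le_energy F : admissible l a b psi M a1 a2 A F ->
  (cap l a b psi M h a1 a2 A <= energy l a b psi h A F)%E.
Proof. by move=> admF; apply: ereal_inf_lbound; exists F. Qed.

Lemma dir_extremal_exists : exists P, dir_extremal l a b psi M h a1 a2 A P.
Proof.
have [P admP PE] := extremal_exists; exists P; split => //.
by rewrite dir_capE; exact: dir_energy_extremal.
Qed.

Section rotational.
Variable H0 : R -> R.
Hypothesis HE : forall t s, strip_dom l a b (t, s) -> H t s = H0 s.

Let q1 t := derive1 H0 (a1 t) * derive1 a1 t.
Let q2 t := derive1 H0 (a2 t) * derive1 a2 t.

Lemma H0_derivable s : a < s < b -> is_derive s 1 H0 (derive1 H0 s).
Proof.
move=> /[dup] sI /andP[as_ sb].
have I0 : (0 : R) <= 0 <= l by rewrite lexx ltW.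
have dom : strip_dom l a b (0, s) by apply/strip_domP.
suff : derivable H0 s 1 by move=> d; rewrite derive1E; exact: derivableP.
have n1 : \forall r \near s, a < r by exact: lt_nbhsr.
have n2 : \forall r \near s, r < b by exact: lt_nbhsl.
apply: (@near_eq_derivable _ _ _ (H 0)); last by have [] := hH dom.
by apply: filterS2 n1 n2 => r r1 r2; apply: HE; apply/strip_domP; rewrite r1.
Qed.

Lemma extremal_profile_d1E t s : 0 < t < l -> derivable a1 t 1 -> derivable a2 t 1 ->
  a1 t < s < a2 t ->
  d1 prof (t, s) = - (q1 t * (H0 (a2 t) - H0 s) + q2 t * (H0 s - H0 (a1 t)))
                 / (H0 (a2 t) - H0 (a1 t)) ^+ 2.
Proof.
move=> /andP[t0 tl] da1 da2 /andP[s1 s2].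
have tI : 0 <= t <= l by rewrite !ltW.
have [at1 t12 t2b] := btw tI.
have dom r y : 0 <= r <= l -> a1 r <= y <= a2 r -> strip_dom l a b (r, y).
  by move=> rI yI; apply: (@region_strip true); apply/regionP.
have Dt0 := section_width_gt0 tI; rewrite /= !HE in Dt0; last 2 first.
- by apply: dom => //; rewrite lexx ltW.
- by apply: dom => //; rewrite lexx ltW.
have c1 : {for t, continuous a1} by apply/differentiable_continuous/derivable1_diffP.
have c2 : {for t, continuous a2} by apply/differentiable_continuous/derivable1_diffP.
have I1 : a < a1 t < b by apply/andP; split; lra.
have I2 : a < a2 t < b by apply/andP; split; lra.
have dH1 := H0_derivable I1; have dH2 := H0_derivable I2.
have da1' : is_derive t 1 a1 (derive1 a1 t) by rewrite derive1E; exact: derivableP.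
have da2' : is_derive t 1 a2 (derive1 a2 t) by rewrite derive1E; exact: derivableP.
have d1' : is_derive t 1 (H0 \o a1) (q1 t) by exact: is_derive1_comp.
have d2' : is_derive t 1 (H0 \o a2) (q2 t) by exact: is_derive1_comp.
pose g r := (H0 s - (H0 \o a1) r) * ((H0 \o a2) r - (H0 \o a1) r)^-1.
have n0 : (H0 \o a2) t - (H0 \o a1) t != 0 by rewrite gt_eqF.
have dg : is_derive t 1 g (- (q1 t * (H0 (a2 t) - H0 s) + q2 t * (H0 s - H0 (a1 t)))
                 / (H0 (a2 t) - H0 (a1 t)) ^+ 2).
  rewrite /g; apply: is_derive_eq.
  rewrite /GRing.scale/=; field.
  by rewrite gt_eqF.
rewrite /d1 derive1E /= -(@derive_val _ _ _ _ _ _ _ dg).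
apply: near_eq_derive.
have m1 : \forall r \near t, a1 r < s by apply: cvgr_lt c1 _ _.
have m2 : \forall r \near t, s < a2 r by apply: cvgr_gt c2 _ _.
have m3 : \forall r \near t, 0 < r by exact: lt_nbhsr.
have m4 : \forall r \near t, r < l by exact: lt_nbhsl.
near=> r.
have rI : 0 <= r <= l by apply/andP; split; apply: ltW; near: r.
have r1 : a1 r < s by near: r.
have r2 : s < a2 r by near: r.
have r12 : a1 r <= a2 r by apply: ltW; exact: lt_trans r2.
rewrite (extremal_profile_mid _ rI) ?(ltW r1) ?(ltW r2)//.
by rewrite !HE//; apply: dom; rewrite ?lexx ?(ltW r1) ?(ltW r2) ?r12.
Unshelve. all: end_near. Qed.

(** In the variable [z = H t s] the derivative of the profile in [t] is, up to
the factor [- (D t)^-1], the affine function with values [q1 t] at [H0 (a1 t)]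
and [q2 t] at [H0 (a2 t)], whose square is easy to integrate. *)
Lemma extremal_section_energy t : 0 < t < l -> derivable a1 t 1 -> derivable a2 t 1 ->
  (\int[lebesgue_measure]_(s in `[a1 t, a2 t])
     ((h t s)^-1 * d1 prof (t, s) ^+ 2 + h t s * d2 prof (t, s) ^+ 2)%:E
   = ((1 + (q1 t ^+ 2 + q1 t * q2 t + q2 t ^+ 2) / 3) / (H0 (a2 t) - H0 (a1 t)))%:E)%E.
Proof.
move=> t0l da1 da2; have /andP[t0 tl] := t0l.
have tI : 0 <= t <= l by rewrite !ltW.
have [at1 t12 t2b] := btw tI.
have E1 : H t (a1 t) = H0 (a1 t).
  by apply: HE; apply/strip_domP; split => //; apply/andP; split; lra.
have E2 : H t (a2 t) = H0 (a2 t).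
  by apply: HE; apply/strip_domP; split => //; apply/andP; split; lra.
have Dt0 := section_width_gt0 tI; rewrite /= E1 E2 in Dt0.
set A1 := H0 (a1 t) in E1 Dt0 *; set A2 := H0 (a2 t) in E2 Dt0 *.
set p := q1 t; set q := q2 t; pose Del := A2 - A1.
have Del0 : 0 < Del by [].
pose Lin z := p * (A2 - z) + q * (z - A1).
pose phi z := Lin z ^+ 2 / Del ^+ 4 + Del ^- 2.
(* The primitive of [phi] that vanishes at [A1], from the expansion
   [Lin z = p * Del + (q - p) * (z - A1)]. *)
pose Phi z := (p ^+ 2 * Del ^+ 2 * (z - A1) + p * Del * (q - p) * (z - A1) ^+ 2
  + (q - p) ^+ 2 * (z - A1) ^+ 3 / 3) / Del ^+ 4 + (z - A1) / Del ^+ 2.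
have dPhi (z : R) : is_derive z 1 Phi (phi z).
  rewrite /Phi /phi /Lin /Del; apply: is_derive_eq.
  rewrite /GRing.scale/=; field.
  by rewrite gt_eqF.
have cphi : continuous phi.
  have cLin : continuous Lin.
    move=> z; apply: cvgD; apply: cvgMr; apply: cvgB; try exact: cvg_cst; exact: cvg_id.
  move=> z; apply: cvgD; last exact: cvg_cst.
  by apply: cvgMl; exact: (cvgM (cLin z) (cLin z)).
have eqo s : s \in `]a1 t, a2 t[%classic ->
    ((h t s)^-1 * d1 prof (t, s) ^+ 2 + h t s * d2 prof (t, s) ^+ 2)%:E
    = (phi (H t s) * (h t s)^-1)%:E.
  move=> /set_mem; rewrite /= in_itv/= => sI; rewrite extremal_profile_d2E// extremal_profile_d1E//.
  have dom := section_strip tI sI.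
  have [h0 _ _ _] := hh dom; rewrite /phi /Lin -(HE dom) E1 E2 -/A1 -/A2 -/p -/q -/Del.
  by congr (_%:E); field; rewrite !gt_eqF.
rewrite integral_itv_bndoo; last first.
  apply: (eq_measurable_fun (fun s => (phi (H t s) * (h t s)^-1)%:E)).
    by move=> s sI; rewrite eqo.
  by apply/measurable_EFinP; exact: section_integrand_measurable.
transitivity (\int[lebesgue_measure]_(s in `]a1 t, a2 t[)
    (phi (H t s) * (h t s)^-1)%:E)%E; first by apply: eq_integral => s; exact: eqo.
rewrite (@section_integral_potential Phi phi t false)// E1 E2 /Phi -/Del subrr.
by congr (_%:E); rewrite -/Del; field; rewrite gt_eqF.
Qed.

Lemma extremal_energy_le (P : S -> R) : (forall u, W u -> P (psi u) = prof u) ->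
  (energy l a b psi h A P <=
   \int[lebesgue_measure]_(t in `[0%R, l])
     ((1 + (q1 t ^+ 2 + q1 t * q2 t + q2 t ^+ 2) / 3) / (H0 (a2 t) - H0 (a1 t)))%:E)%E.
Proof.
move=> PE; rewrite /energy region_preimage.
have PE2 u : region true u -> d1 (P \o psi) u = d1 prof u /\ d2 (P \o psi) u = d2 prof u.
  move=> ru; have Wu : W u.
    by apply: (strip_dom_chart eps0 ba); exact: region_strip ru.
  by rewrite (eq_on_open_d1 open_chart_domain PE Wu) (eq_on_open_d2 open_chart_domain PE Wu).
under eq_integral => u /set_mem ru.
  have [-> ->] := PE2 _ ru.
  over.
pose e u : \bar R := ((h u.1 u.2)^-1 * d1 prof u ^+ 2 + h u.1 u.2 * d2 prof u ^+ 2)%:E.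
have me : measurable_fun (region true) e.
  have [mh mih] := metric_measurable true.
  apply/measurable_EFinP; apply: measurable_funD; apply: measurable_funM.
  - exact: mih.
  - apply: measurable_funX; apply: measurable_funTS.
    exact: measurable_d1 extremal_profile_continuous.
  - exact: mh.
  - apply: measurable_funX; apply: measurable_funTS.
    exact: measurable_d2 extremal_profile_continuous.
have e_ge0 u : region true u -> (0 <= e u)%E.
  move=> ru; have h0 := metric_gt0 ru.
  by rewrite lee_fin addr_ge0// mulr_ge0 ?sqr_ge0 ?invr_ge0// ltW.
rewrite (between_tonelli hl pw1 pw2 me e_ge0).
have [_ [D1 der1]] := pw1; have [_ [D2 der2]] := pw2.
(* The boundary curves are differentiable off a finite set of parameters. *)
pose N : set R := [set` 0 :: l :: D1 ++ D2].
have cN : countable N by apply: finite_set_countable; exact: finite_seq.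
have mN : measurable (N : set (measurableTypeR R)).
  by apply: countable_measurable => // t; exact: measurable_set1.
have N0 := countable_lebesgue_measure0 cN.
have mI : measurable (`[0, l]%classic : set (measurableTypeR R)) by [].
rewrite (ge0_negligible_integral mN mI _ _ N0); last 2 first.
- exact: (between_inner_measurable hl pw1 pw2 me e_ge0).
- move=> t; rewrite /= in_itv/= => tI; apply: integral_ge0 => s sI.
  by apply: e_ge0; apply/regionP; split => //; move: sI; rewrite /= in_itv.
have good t : (`[0, l] `\` N) t ->
    [/\ 0 < t < l, derivable a1 t 1 & derivable a2 t 1].
  move=> [/=]; rewrite in_itv/= => /andP[t0 tl] tN.
  have [tn0 tnl tn1 tn2] : [/\ t != 0, t != l, t \notin D1 & t \notin D2].
    by split; apply/negP => tE; apply: tN; rewrite /N /= !inE mem_cat tE ?orbT.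
  have t0l : 0 < t < l by rewrite !lt_neqAle eq_sym tn0 t0 tnl tl.
  by split => //; [exact: der1|exact: der2].
have target_ge0 t : `[0, l]%classic t ->
    (0 <= ((1 + (q1 t ^+ 2 + q1 t * q2 t + q2 t ^+ 2) / 3)
             / (H0 (a2 t) - H0 (a1 t)))%:E)%E.
  rewrite /= in_itv/= => tI; have [at1 t12 t2b] := btw tI.
  have := section_width_gt0 tI; rewrite /= !HE; last 2 first.
  - by apply/strip_domP; split => //; apply/andP; split; lra.
  - by apply/strip_domP; split => //; apply/andP; split; lra.
  move=> Dt0; rewrite lee_fin divr_ge0 ?(ltW Dt0)// addr_ge0// divr_ge0//.
  have -> : q1 t ^+ 2 + q1 t * q2 t + q2 t ^+ 2
    = (q1 t + q2 t / 2) ^+ 2 + 3 / 4 * q2 t ^+ 2 by field.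
  by rewrite addr_ge0 ?sqr_ge0// mulr_ge0 ?sqr_ge0// divr_ge0.
have sub : `[0, l] `\` N `<=` `[0, l] by exact: subDsetl.
have := @ge0_subset_integral_lower _ _ R (@lebesgue_measure R) _ _ _ sub target_ge0.
apply: le_trans; rewrite le_eqVlt; apply/orP; left; apply/eqP.
apply: eq_integral => t /set_mem /good[].
exact: extremal_section_energy.
Qed.

End rotational.

End capacity.

(** * Bounds for the capacity of an annulus *)

Theorem theorem4p1 (R : realType) (E : surface R) (K : R)
  (hE : surface_EK E K)
  (l a b : R) (psi : R * R -> E) (M : E -> E) (h H : R -> R -> R)
  (hl : 0 < l) (hldiam : (l%:E < diameter E)%E)
  (hab : a < 0 <= b) (hba : `|b| <= `|a|)
  (hadiam : ((2 * `|a|)%:E < diameter E)%E)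
  (hpsi : fermi_coordinates l a psi)
  (hM : gluing l a b psi M)
  (hh : fermi_metric l a b psi h)
  (hH : forall t s, strip_dom l a b (t, s) -> is_derive s 1 (H t) (h t s)^-1)
  (a1 a2 : R -> R) (A : set E)
  (hA : annulus l a b psi M A)
  (htA : type_A l a b psi a1 a2 A) :
  (exists P, dir_extremal l a b psi M h a1 a2 A P) /\
  (forall P, dir_extremal l a b psi M h a1 a2 A P ->
    [/\ (cap l a b psi M h a1 a2 A <= energy l a b psi h A P)%E,
        (dir_cap l a b psi M h a1 a2 A <= cap l a b psi M h a1 a2 A)%E,
        dir_cap l a b psi M h a1 a2 A = dir_energy l a b psi h A P &
        dir_energy l a b psi h A P =
          (\int[lebesgue_measure]_(t in `[0%R, l])
             ((H t (a2 t) - H t (a1 t))^-1)%:E)%E]) /\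
  (cyl_constant_curvature l a b psi K ->
    (forall t t' s, 0 <= t <= l -> 0 <= t' <= l -> a < s < b ->
       h t s = h t' s) /\
    forall H0 : R -> R,
      (forall t s, strip_dom l a b (t, s) -> H t s = H0 s) ->
      let q1 := fun t => derive1 H0 (a1 t) * derive1 a1 t in
      let q2 := fun t => derive1 H0 (a2 t) * derive1 a2 t in
      (cap l a b psi M h a1 a2 A <=
         \int[lebesgue_measure]_(t in `[0%R, l])
           ((1 + (q1 t ^+ 2 + q1 t * q2 t + q2 t ^+ 2) / 3)
              / (H0 (a2 t) - H0 (a1 t)))%:E)%E /\
      (\int[lebesgue_measure]_(t in `[0%R, l])
           ((H0 (a2 t) - H0 (a1 t))^-1)%:E
         <= cap l a b psi M h a1 a2 A)%E).
Proof.
have /andP[a0 b0] := hab.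
have ba : b <= - a by move: hba; rewrite ger0_norm// ltr0_norm.
have [eps eps0 /= [ch gF0 gG1 base]] := fermi_first_form a0 hpsi.
have [_ _ curvE] := hE.
have [kappa hkappa] : exists kappa, gauss_curvature (S := E) kappa.
  by case: curvE => [?|[kappa [? _ _]]]; [exists (fun=> K)|exists kappa].
have [_ glue] := hM.
have [[pw1 pw2] btw [per1 per2] AE] := htA.
have h_of_gE t t' s : strip_dom l a b (t, s) -> strip_dom l a b (t', s) ->
    gE psi (t, s) = gE psi (t', s) -> h t s = h t' s.
  move=> /hh[h0 -> _ _] /hh[h0' -> _ _] /eqP.
  by rewrite eqrXn2 ?ltW// => /eqP.
have dom t s : 0 <= t <= l -> a < s < b -> strip_dom l a b (t, s).
  by move=> ? ?; apply/strip_domP.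
have I0 : (0 : R) <= 0 <= l by rewrite lexx ltW.
have Il : (0 : R) <= l <= l by rewrite lexx ltW.
have hper s : a < s < b -> h 0 s = h l s.
  move=> sI; apply: h_of_gE; [exact: dom|exact: dom|].
  exact: (isometric_sides_same_profile hl hab hba eps0 hkappa hM ch gF0 gG1 base).
have capE := dir_capE hl eps0 ba ch hh glue hH hper pw1 pw2 btw per1 per2 AE.
have le_cap := dir_cap_le_cap M eps0 ba ch hh btw AE.
split; [|split].
- exact: (dir_extremal_exists hl eps0 ba ch hh glue hH hper pw1 pw2 btw per1 per2 AE).
- move=> P [admP PE]; split => //; last by rewrite PE.
  exact: cap_le_energy.
move=> curvK; split.
  move=> t t' s tI tI' sI; apply: h_of_gE; [exact: dom|exact: dom|].
  have wide r : 0 <= r <= l -> - eps < r < l + eps.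
    by move=> /andP[? ?]; apply/andP; split; lra.
  have curvL t1 r : 0 <= t1 <= l -> a < r < b ->
      brioschi (gE psi) (gF psi) (gG psi) (t1, r) = K.
    move=> t1I rI; have sd := dom _ _ t1I rI.
    apply: (curvK _ _ _ ch); last by exists (t1, r).
    exact: (strip_dom_chart eps0 ba).
  have eq_curv r : a < r < b -> brioschi (gE psi) (gF psi) (gG psi) (t, r)
      = brioschi (gE psi) (gF psi) (gG psi) (t', r).
    by move=> rI; rewrite !curvL.
  have := same_curvature_same_profile hab hba ch gF0 gG1 base (wide _ tI) (wide _ tI') eq_curv.
  exact.
move=> H0 HE.
have IE : (\int[lebesgue_measure]_(t in `[0%R, l]) ((H t (a2 t) - H t (a1 t))^-1)%:E
  = \int[lebesgue_measure]_(t in `[0%R, l]) ((H0 (a2 t) - H0 (a1 t))^-1)%:E)%E.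
  apply: eq_integral => t /set_mem; rewrite /= in_itv/= => tI.
  have [? ? ?] := btw _ tI.
  by rewrite !HE//; apply: dom => //; apply/andP; split; lra.
split; last by rewrite -IE -capE.
have [P admP PE] := extremal_exists A hl eps0 ba ch hh glue hH hper pw1 pw2 btw per1 per2.
apply: le_trans (cap_le_energy h admP) _.
exact: (extremal_energy_le hl eps0 ba ch hh hH pw1 pw2 btw AE HE PE).
Qed.
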